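(* Let $n,m,k$ be positive integers. If $(T_1,\ldots,T_n)\in B(\mathcal H)^{(n)}$ is an $n$-tuple of operators with joint numerical radius $w(T_1,\ldots,T_n)\le1$ and $F_1,\ldots,F_k\in M_m\otimes\mathcal A_n$, then $$w\big(F_1(T_1,\ldots,T_n),\ldots,F_k(T_1,\ldots,T_n)\big)\le\|[F_1,\ldots,F_k]\|+2\left(\sum_{j=1}^k\|F_j(0)\|^2\right)^{1/2}.$$
   Context: $\mathcal H$ is a complex Hilbert space. $F^2(H_n)=\bigoplus_{k\ge0}H_n^{\otimes k}$ is the full Fock space of an $n$-dimensional Hilbert space with orthonormal basis $e_1,\ldots,e_n$; $S_i\psi=e_i\otimes\psi$ are the left creation operators; $\mathcal A_n$ (noncommutative disc algebra) is the norm closed algebra generated by $S_1,\ldots,S_n,I$. $\mathbb F_n^+$ is the unital free semigroup on $g_1,\ldots,g_n$ with identity $g_0$; $T_\alpha=T_{i_1}\cdots T_{i_k}$ for $\alpha=g_{i_1}\cdots g_{i_k}$. $M_m\otimes\mathcal A_n$ is the set of $m\times m$ matrices over $\mathcal A_n$; $\|[F_1,\ldots,F_k]\|$ is the norm of the row operator. For $f\in\mathcal A_n$, $f(0):=\langle f1,1\rangle$, and when $w(T_1,\ldots,T_n)\le1$, $f(T_1,\ldots,T_n):=\lim_jp_j(T_1,\ldots,T_n)$ in norm for any sequence of noncommutative polynomials with $p_j(S_1,\ldots,S_n)\to f$ in norm (for such tuples $p(S_1,\ldots,S_n)\mapsto p(T_1,\ldots,T_n)$ is completely bounded, so this is well defined).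 For matrices, $F(0)$ and $F(T_1,\ldots,T_n)\in B(\mathcal H^{(m)})$ are defined entrywise. Joint numerical radius of $(X_1,\ldots,X_d)$ on a Hilbert space $\mathcal L$: $w(X_1,\ldots,X_d):=\sup\left|\sum_{\alpha\in\mathbb F_d^+}\sum_{j=1}^d\langle h_\alpha,X_jh_{g_j\alpha}\rangle\right|$, over all families $\{h_\alpha\}_{\alpha\in\mathbb F_d^+}\subset\mathcal L$ with $\sum_\alpha\|h_\alpha\|^2=1$. *)

(* Defs.v *)
From HB Require Import structures.
From mathcomp Require Import all_boot all_order all_algebra finmap.
From mathcomp Require Import all_classical all_reals all_analysis.
From mathcomp Require Import ring.
From mathcomp.real_closed Require Import complex.
From mathcomp.analysis Require Import showcase.summability.

Set Implicit Arguments.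
Unset Strict Implicit.
Unset Printing Implicit Defensive.
Import Order.TTheory GRing.Theory Num.Theory.
Import numFieldNormedType.Exports.
Local Open Scope classical_set_scope.
Local Open Scope ring_scope.

Import Normc.

Section ComplexSums.
Variable R : realType.

Lemma normcE (z : R[i]) : `|z| = (normc z)%:C%C.
Proof. by case: z. Qed.

Lemma normc_ge0 (z : R[i]) : 0 <= normc z.
Proof. by case: z => a b; exact: sqrtr_ge0. Qed.

Lemma Re_le_normc (z : R[i]) : `|complex.Re z| <= normc z.
Proof. by case: z => a b /=; rewrite -sqrtr_sqr ler_wsqrtr// lerDl sqr_ge0. Qed.

Lemma Im_le_normc (z : R[i]) : `|complex.Im z| <= normc z.
Proof. by case: z => a b /=; rewrite -sqrtr_sqr ler_wsqrtr// lerDr sqr_ge0. Qed.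

Definition abs_summable (I : choiceType) (x : I -> R[i]) :=
  (\esum_(i in [set: I]) (normc (x i))%:E < +oo)%E.

(* Sum of an unconditionally convergent complex family: the limit of its finite
   partial sums along the directed set of finite subsets of the index type. *)
Definition csum (I : choiceType) (x : I -> R[i]) : R[i] :=
  @summability.sum I R[i] (R[i])^o x.

Lemma fsbig_partial_sum (I : choiceType) (V : nmodType) (x : I -> V) (A : {fset I}) :
  \sum_(i \in [set` A]) x i = \sum_(i <- A) x i.
Proof. by rewrite fsbig_finite//= set_fsetK. Qed.

Lemma esum_le_fset (I : choiceType) (x : I -> R) (M : R) :
  (forall A : {fset I}, \sum_(i <- A) x i <= M) ->
  (\esum_(i in [set: I]) (x i)%:E <= M%:E)%E.
Proof.
move=> H; apply: ge_ereal_sup => _ [A [finA _] <-].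
rewrite fsbig_finite//= sumEFin lee_fin.
exact: H.
Qed.

Lemma fset_le_esum (I : choiceType) (x : I -> R) (A : {fset I}) :
  (((\sum_(i <- A) x i)%R)%:E <= \esum_(i in [set: I]) (x i)%:E)%E.
Proof.
apply: ereal_sup_ubound; exists [set` A] => //.
by rewrite fsbig_partial_sum sumEFin.
Qed.

Local Existing Instance totally_filter.

Lemma ge0_partial_sum_cvg (I : choiceType) (x : I -> R) :
  (forall i, 0 <= x i) -> (\esum_(i in [set: I]) (x i)%:E < +oo)%E ->
  (fun A : {fset I} => \sum_(i <- A) x i) @ totally -->
    fine (\esum_(i in [set: I]) (x i)%:E)%E.
Proof.
move=> x0 xoo; set s := esum _ _.
have sfin : s \is a fin_num.
  by rewrite ge0_fin_numE//; apply: esum_ge0 => i _; rewrite lee_fin.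
apply/cvgrPdist_lt => e e0.
have : (s - e%:E < s)%E by rewrite lteBlDr// lteDl// lte_fin.
move=> /ereal_sup_gt[_ [A [finA _] <-]].
rewrite fsbig_finite//= sumEFin -(fineK sfin) -EFinB lte_fin => Ae.
exists (fset_set A) => //= B /= AB.
have sB : \sum_(i <- B) x i <= fine s.
  by rewrite -lee_fin fineK// fset_le_esum.
rewrite ger0_norm ?subr_ge0// ltrBlDr -ltrBlDl; apply: (lt_le_trans Ae).
rewrite [leRHS](big_fsetID _ (mem (fset_set A)))/=.
have -> : \sum_(i <- [fset x0 | x0 in B & x0 \in fset_set A]%fset) x i =
   \sum_(i <- fset_set A) x i.
  apply: eq_fbigl => i; rewrite !inE/= andbC.
  by case iA : (i \in fset_set A) => //=; rewrite (fsubsetP AB).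
by rewrite lerDl sumr_ge0.
Qed.

Lemma summable_partial_sum_cvg (I : choiceType) (x : I -> R) :
  (\esum_(i in [set: I]) `|x i|%:E < +oo)%E ->
  exists l : R, (fun A : {fset I} => \sum_(i <- A) x i) @ totally --> l.
Proof.
move=> xoo.
have h (y : I -> R) : (forall i, 0 <= y i <= `|x i|) ->
  (\esum_(i in [set: I]) (y i)%:E < +oo)%E.
  move=> H; apply: le_lt_trans xoo; apply: le_esum => i _.
  by rewrite lee_fin; case/andP: (H i).
have h1 : (\esum_(i in [set: I]) (`|x i| - x i)%:E < +oo)%E.
  have -> : (\esum_(i in [set: I]) (`|x i| - x i)%:E =
     \esum_(i in [set: I]) ((`|x i| - x i)/2)%:E
     + \esum_(i in [set: I]) ((`|x i| - x i)/2)%:E)%E.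
    have p i : (0 <= ((`|x i| - x i) / 2)%:E)%E.
      by rewrite lee_fin divr_ge0// subr_ge0 ler_norm.
    rewrite -esumD//; apply: eq_esum => i _.
    by rewrite -EFinD -splitr.
  have q i : 0 <= (`|x i| - x i) / 2 <= `|x i|.
    rewrite divr_ge0 ?subr_ge0 ?ler_norm//= ler_pdivrMr// mulr_natr mulr2n.
    by rewrite lerD2l -normrN ler_norm.
  by rewrite lte_add_pinfty// h.
have a0 : forall i, 0 <= `|x i| by [].
have b0 i : 0 <= `|x i| - x i by rewrite subr_ge0 ler_norm.
exists (fine (\esum_(i in [set: I]) `|x i|%:E)%E
  - fine (\esum_(i in [set: I]) (`|x i| - x i)%:E)%E).
have -> : (fun A : {fset I} => \sum_(i <- A) x i) =
    (fun A : {fset I} => \sum_(i <- A) `|x i|) \-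
    (fun A : {fset I} => \sum_(i <- A) (`|x i| - x i)).
  apply/funext => A /=.
  by rewrite -sumrB; apply: eq_bigr => i _; rewrite opprB addrC subrK.
exact: cvgB (ge0_partial_sum_cvg a0 xoo) (ge0_partial_sum_cvg b0 h1).
Qed.

Lemma real_complex_cvg (T : Type) (F : set_system T) (FF : Filter F)
    (f : T -> R) (l : R) :
  f @ F --> l -> ((fun t => (f t)%:C%C) : T -> R[i]^o) @ F --> (l%:C%C : R[i]^o).
Proof.
move=> fl; apply/cvgrPdist_lt => e; rewrite ltcE/= => /andP[/eqP e1 e2].
move/cvgrPdist_lt : fl => /(_ _ e2) H; near=> t.
have : `|l - f t| < complex.Re e by near: t.
rewrite -ltcR.
have -> : (complex.Re e)%:C%C = e by case: (e) e1 => a b /= ->.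
apply: le_lt_trans.
by rewrite -rmorphB/= normcE /= expr0n/= addr0 sqrtr_sqr.
Unshelve. all: by end_near.
Qed.

Lemma abs_summable_cvg (I : choiceType) (x : I -> R[i]) : abs_summable x ->
  (partial_sum (x : I -> R[i]^o)) @ totally --> (csum x : R[i]^o).
Proof.
move=> xs.
have [l1 xl1] : exists l : R,
    (fun A : {fset I} => \sum_(i <- A) complex.Re (x i)) @ totally --> l.
  apply: summable_partial_sum_cvg; apply: le_lt_trans xs.
  by apply: le_esum => i _; rewrite lee_fin Re_le_normc.
have [l2 xl2] : exists l : R,
    (fun A : {fset I} => \sum_(i <- A) complex.Im (x i)) @ totally --> l.
  apply: summable_partial_sum_cvg; apply: le_lt_trans xs.
  by apply: le_esum => i _; rewrite lee_fin Im_le_normc.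
apply/cvg_ex; exists ((l1%:C + 'i * l2%:C)%C : R[i]^o).
have -> : partial_sum (x : I -> R[i]^o) =
    (fun A : {fset I} => (\sum_(i <- A) complex.Re (x i))%:C%C : R[i]^o) \+
    (fun A : {fset I} => ('i%C : R[i]) *:
      ((\sum_(i <- A) complex.Im (x i))%:C%C : R[i]^o)).
  apply/funext => A /=.
  rewrite /partial_sum -(big_seq_fsetE _ _ xpredT x)/=.
  rewrite !rmorph_sum/= scaler_sumr -big_split/=.
  by apply: eq_bigr => i _; rewrite [LHS]complexE.
apply: cvgD; first exact: real_complex_cvg.
by apply: cvgZr; exact: real_complex_cvg.
Qed.

Lemma csum_eq (I : choiceType) (x : I -> R[i]) (l : R[i]) :
  partial_sum (x : I -> R[i]^o) @ totally --> (l : R[i]^o) -> csum x = l.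
Proof. exact: cvg_lim. Qed.

Lemma csumP (I : choiceType) (a : R[i]) (x y : I -> R[i]) :
  abs_summable x -> abs_summable y ->
  csum (fun i => a * x i + y i) = a * csum x + csum y.
Proof.
move=> sx sy; apply: csum_eq.
have -> : partial_sum ((fun i => a * x i + y i) : I -> R[i]^o) =
    (fun A => a *: partial_sum (x : I -> R[i]^o) A) \+
    partial_sum (y : I -> R[i]^o).
  by apply/funext => A /=; rewrite /partial_sum scaler_sumr -big_split.
apply: cvgD; last exact: abs_summable_cvg.
by apply: cvgZr; exact: abs_summable_cvg.
Qed.

Lemma csum_conj (I : choiceType) (x : I -> R[i]) : abs_summable x ->
  csum (fun i => (x i)^*) = (csum x)^*.
Proof.
move=> sx; apply: csum_eq.
have /cvgrPdist_lt H := abs_summable_cvg sx.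
apply/cvgrPdist_lt => e e0; near=> A.
have : `|(csum x : R[i]^o) - partial_sum (x : I -> R[i]^o) A| < e by near: A; exact: H.
apply: le_lt_trans.
rewrite /partial_sum -rmorph_sum -rmorphB/=.
by rewrite le_eqVlt (@norm_conjC R[i]) eqxx.
Unshelve. all: by end_near.
Qed.

Lemma csum_ge0 (I : choiceType) (x : I -> R) : (forall i, 0 <= x i) ->
  (\esum_(i in [set: I]) (x i)%:E < +oo)%E ->
  csum (fun i => (x i)%:C%C) = (fine (\esum_(i in [set: I]) (x i)%:E)%E)%:C%C.
Proof.
move=> x0 xoo; apply: csum_eq.
have -> : partial_sum ((fun i => (x i)%:C%C) : I -> R[i]^o) =
   (fun A : {fset I} => (\sum_(i <- A) x i)%:C%C : R[i]^o).
  apply/funext => A; rewrite rmorph_sum /partial_sum.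
  by rewrite -(big_seq_fsetE _ _ xpredT (fun i => (x i)%:C%C)).
by apply: real_complex_cvg; exact: ge0_partial_sum_cvg.
Qed.

End ComplexSums.

HB.mixin Record Lmodule_hasInner (R : realType) H & GRing.Lmodule R[i] H := {
  inner : {dot H for (@Num.conj R[i])}
}.

#[short(type="innerType")]
HB.structure Definition InnerSpace (R : realType) :=
  {H of GRing.Lmodule R[i] H & Lmodule_hasInner R H}.

Definition hnorm (R : realType) (H : innerType R) (x : H) : R :=
  Num.sqrt (complex.Re (inner x x)).

HB.mixin Record InnerSpace_isComplete (R : realType) H & InnerSpace R H := {
  hilbert_complete : forall u : nat -> H,
    (forall e : R, 0 < e ->
      exists N, forall p q, (N <= p)%N -> (N <= q)%N -> hnorm (u p - u q) < e) ->
    exists l : H, hnorm (u p - l) @[p --> \oo] --> (0 : R)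
}.

#[short(type="hilbertType")]
HB.structure Definition Hilbert (R : realType) :=
  {H of InnerSpace R H & InnerSpace_isComplete R H}.

Section InnerTheory.
Variables (R : realType) (H : innerType R).
Implicit Types x y : H.

Lemma innerE x : inner x x = (hnorm x ^+ 2)%:C%C.
Proof.
have := dnorm_ge0 (@inner R H) x; rewrite /hnorm.
case: (inner x x) => a b; rewrite lecE /= => /andP[/eqP-> a0].
by rewrite sqr_sqrtr.
Qed.

Lemma hnorm_ge0 x : 0 <= hnorm x. Proof. exact: sqrtr_ge0. Qed.

Lemma hnorm0 : hnorm (0 : H) = 0.
Proof. by rewrite /hnorm linear0r sqrtr0. Qed.

Lemma hnorm_eq0 x : hnorm x = 0 -> x = 0.
Proof.
move=> x0; apply/eqP; rewrite -(dnorm_eq0 (@inner R H)).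
by rewrite innerE x0 expr0n.
Qed.

Lemma hnormZ (a : R[i]) x : hnorm (a *: x) = normc a * hnorm x.
Proof.
apply: (@pexpIrn _ 2) => //; rewrite ?nnegrE ?mulr_ge0 ?hnorm_ge0 ?normc_ge0//.
apply: complexI; rewrite -innerE dnormZ innerE normcE exprMn rmorphM.
by rewrite !expr2 !rmorphM.
Qed.

Lemma inner_CauchySchwarz x y : normc (inner x y) <= hnorm x * hnorm y.
Proof.
have [->|y0] := eqVneq y 0.
  by rewrite linear0r normc0 mulr_ge0// hnorm_ge0.
pose a := inner x y / inner y y; pose x1 := x - a *: y.
have o1 : inner x1 y = 0.
  by rewrite linearBl/= linearZl_LR/= divfK ?dnorm_eq0 ?subrr.
have x1E : x = x1 + a *: y by rewrite subrK.
have : `|inner x y| ^+ 2 <= inner x x * inner y y.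
  rewrite x1E linearDl/= o1 add0r linearZl_LR/= normrM.
  rewrite (ger0_norm (dnorm_ge0 _ _)) exprMn.
  rewrite hnormDd/=; last by rewrite linearZr_LR/= o1 mulr0.
  rewrite mulrDl dnormZ (expr2 (inner y y)) mulrA lerDr mulr_ge0 ?dnorm_ge0//.
rewrite !innerE normcE -!rmorphXn -rmorphM/= lecR -exprMn.
by rewrite ler_sqr ?nnegrE ?mulr_ge0 ?hnorm_ge0 ?normc_ge0.
Qed.

Lemma ler_hnormD x y : hnorm (x + y) <= hnorm x + hnorm y.
Proof.
rewrite -ler_sqr ?nnegrE ?addr_ge0 ?hnorm_ge0// -lecR -innerE.
rewrite dnormD !innerE sqrrD.
have -> : inner x y + (inner x y)^* = ((complex.Re (inner x y)) *+ 2)%:C%C.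
  rewrite mulr2n; case: (inner x y) => a b; apply/eqP.
  by rewrite eq_complex/= subrr !eqxx.
rewrite -!rmorphD lecR addrAC lerD2r lerD2l lerMn2r/=.
apply: le_trans (inner_CauchySchwarz x y).
exact: le_trans (ler_norm _) (Re_le_normc _).
Qed.

Lemma ler_hnorm_sum (I : Type) (r : seq I) (f : I -> H) :
  hnorm (\sum_(i <- r) f i) <= \sum_(i <- r) hnorm (f i).
Proof.
elim/big_rec2: _ => [|i y x _ H1]; first by rewrite hnorm0.
by rewrite (le_trans (ler_hnormD _ _))// lerD2l.
Qed.

End InnerTheory.

Section Operators.
Variables (R : realType) (H K : innerType R).

Definition bounded_linear : {pred H -> K} := fun T =>
  `[< linear T /\ exists M : R, forall x, hnorm (T x) <= M * hnorm x >].

Lemma bounded_linearP (T : H -> K) :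
  reflect (linear T /\ exists M : R, forall x, hnorm (T x) <= M * hnorm x)
    (T \in bounded_linear).
Proof. exact: asboolP. Qed.

Fact bounded_linear_submod : submod_closed bounded_linear.
Proof.
split=> [|a S T /bounded_linearP[lS [M SM]] /bounded_linearP[lT [N TN]]].
  apply/bounded_linearP; split=> [a x y|]; first by rewrite /= scaler0 addr0.
  by exists 0 => x; rewrite mul0r hnorm0.
apply/bounded_linearP; split=> [b x y|].
  change (a *: S (b *: x + y) + T (b *: x + y) =
    b *: (a *: S x + T x) + (a *: S y + T y)).
  by rewrite lS lT !scalerDr !scalerA [a * b]mulrC addrACA.
exists (normc a * M + N) => x.
rewrite (le_trans (ler_hnormD _ _))// mulrDl lerD//.
by rewrite hnormZ -mulrA ler_wpM2l ?normc_ge0.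
Qed.

HB.instance Definition _ :=
  GRing.isSubmodClosed.Build R[i] (H -> K) bounded_linear bounded_linear_submod.

Record bop : Type := Bop {
  bop_fun :> H -> K;
  bop_bounded_linear : bop_fun \in bounded_linear
}.

HB.instance Definition _ := [isSub for bop_fun].
HB.instance Definition _ := [Choice of bop by <:].
HB.instance Definition _ := [SubChoice_isSubLmodule of bop by <:].

Definition opnorm (T : bop) : R :=
  inf [set M | 0 <= M /\ forall x, hnorm (T x) <= M * hnorm x].

Definition bop_cvg (X : nat -> bop) (Y : bop) : Prop :=
  opnorm (X p - Y) @[p --> \oo] --> (0 : R).

Lemma bop_linear (T : bop) : linear T.
Proof. by have /bounded_linearP[] := bop_bounded_linear T. Qed.

HB.instance Definition _ (T : bop) :=
  GRing.isLinear.Build R[i] H K _ T (bop_linear T).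

Lemma bop_bounded (T : bop) :
  exists2 M : R, 0 <= M & forall x, hnorm (T x) <= M * hnorm x.
Proof.
have /bounded_linearP[_ [M TM]] := bop_bounded_linear T.
exists (Num.max 0 M) => [|x]; first by rewrite le_max lexx.
by rewrite (le_trans (TM x))// ler_wpM2r ?hnorm_ge0// le_max lexx orbT.
Qed.

Lemma opnormP (T : bop) x : hnorm (T x) <= opnorm T * hnorm x.
Proof.
have [M M0 TM] := bop_bounded T.
have [->|x0] := eqVneq x 0; first by rewrite linear0 !hnorm0 mulr0.
have hx : 0 < hnorm x.
  by rewrite lt_neqAle hnorm_ge0 andbT eq_sym; apply: contra x0 => /eqP/hnorm_eq0->.
rewrite -ler_pdivrMr//; apply: lb_le_inf; first by exists M.
by move=> N [_ TN]; rewrite ler_pdivrMr.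
Qed.

End Operators.

Notation "''B' ( H , K )" := (bop H K)
  (at level 8, format "''B' ( H ,  K )") : type_scope.
Notation "''B' ( H )" := (bop H H)
  (at level 8, format "''B' ( H )") : type_scope.

Section OperatorAlgebra.
Variable R : realType.

Fact bop_id_subproof (H : innerType R) : @idfun H \in @bounded_linear R H H.
Proof.
by apply/bounded_linearP; split=> [//|]; exists 1 => x; rewrite mul1r.
Qed.
Definition bop_id (H : innerType R) := Bop (bop_id_subproof H).

Fact bop_comp_subproof (H K L : innerType R) (S : 'B(K, L)) (T : 'B(H, K)) :
  S \o T \in @bounded_linear R H L.
Proof.
have [M M0 SM] := bop_bounded S; have [N N0 TN] := bop_bounded T.
apply/bounded_linearP; split=> [a x y|]; first by rewrite /= !linearP.
exists (M * N) => x.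
by rewrite (le_trans (SM _))// -mulrA ler_wpM2l.
Qed.
Definition bop_comp (H K L : innerType R) (S : 'B(K, L)) (T : 'B(H, K)) :=
  Bop (bop_comp_subproof S T).

(* The free semigroup on g_0, ..., g_(n-1): [:: i_1; ...; i_k] stands for
   g_(i_1) ... g_(i_k), [::] for the identity, and j :: al for g_j al. *)
Definition word n : choiceType := seq 'I_n.

Definition opword n (H : innerType R) (T : 'I_n -> 'B(H)) (al : word n) : 'B(H) :=
  foldr (fun i X => bop_comp (T i) X) (bop_id H) al.

(* noncommutative polynomials, as finitely supported families of coefficients *)
Definition ncpoly n := {fsfun word n -> R[i] with 0}.

Definition ncpoly_eval n (H : innerType R) (T : 'I_n -> 'B(H)) (p : ncpoly n) : 'B(H) :=
  \sum_(al <- finsupp p) p al *: opword T al.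

Definition norm_closed_algebra (H : innerType R) (A : set 'B(H)) : Prop :=
  [/\ forall a X Y, A X -> A Y -> A (a *: X + Y),
      forall X Y, A X -> A Y -> A (bop_comp X Y) &
      forall (X : nat -> 'B(H)) Y, (forall p, A (X p)) -> bop_cvg X Y -> A Y].

End OperatorAlgebra.

Section DirectSum.
Variables (R : realType) (m : nat) (H : innerType R).
Implicit Types x y : {ffun 'I_m -> H}.

Definition dsum_inner x y : R[i] := \sum_j inner (x j) (y j).

Fact dsum_inner_bilinear :
  bilinear_for ( *%R : R[i] -> R[i] -> R[i]) (Num.conj \; *%R) dsum_inner.
Proof.
split=> [u a x y|u a x y]; rewrite /dsum_inner/= mulr_sumr -big_split/=;
  apply: eq_bigr => j _; rewrite !ffunE.
  by rewrite linearPl.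
by rewrite linearPr.
Qed.
HB.instance Definition _ := bilinear_isBilinear.Build
  R[i] _ _ _ _ _ dsum_inner dsum_inner_bilinear.

Fact dsum_inner_hermitian x y :
  dsum_inner x y = (-1) ^+ false * Num.conj (dsum_inner y x).
Proof.
rewrite mul1r /dsum_inner rmorph_sum; apply: eq_bigr => j _.
by rewrite [LHS]hermC mul1r.
Qed.
HB.instance Definition _ := isHermitianSesquilinear.Build
  R[i] _ false Num.conj dsum_inner dsum_inner_hermitian.

Fact dsum_inner_gt0 x : x != 0 -> 0 < dsum_inner x x.
Proof.
move=> x0; have [j xj] : exists j, x j != 0.
  apply/existsP; apply: contraNT x0; rewrite negb_exists => /forallP xj.
  by apply/eqP/ffunP => j; rewrite ffunE; apply/eqP; rewrite -[_ == _]negbK.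
rewrite /dsum_inner (bigD1 j)//= ltr_pwDl ?dnorm_gt0//.
by apply: sumr_ge0 => i _; exact: dnorm_ge0.
Qed.
HB.instance Definition _ := isDotProduct.Build
  R[i] _ dsum_inner dsum_inner_gt0.

HB.instance Definition _ :=
  Lmodule_hasInner.Build R {ffun 'I_m -> H} dsum_inner.

End DirectSum.

Section DirectSumNorm.
Variables (R : realType) (H : innerType R).

Lemma hnorm_dsum m (x : {ffun 'I_m -> H}) :
  hnorm x ^+ 2 = \sum_j hnorm (x j) ^+ 2.
Proof.
apply: complexI; rewrite -innerE rmorph_sum.
change (dsum_inner x x = \sum_j (hnorm (x j) ^+ 2)%:C%C).
by apply: eq_bigr => j _; rewrite innerE.
Qed.

Lemma hnorm_dsum_comp m (x : {ffun 'I_m -> H}) j : hnorm (x j) <= hnorm x.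
Proof.
rewrite -ler_sqr ?nnegrE ?hnorm_ge0// hnorm_dsum (bigD1 j)//= lerDl.
by apply: sumr_ge0 => i _; exact: sqr_ge0.
Qed.

Lemma hnorm_dsum_le m (x : {ffun 'I_m -> H}) : hnorm x <= \sum_j hnorm (x j).
Proof.
have S0 r : 0 <= \sum_(j <- r) hnorm (x j).
  by apply: sumr_ge0 => i _; exact: hnorm_ge0.
rewrite -ler_sqr ?nnegrE ?hnorm_ge0// hnorm_dsum.
elim: index_enum => [|j r IH]; first by rewrite !big_nil expr0n.
rewrite !big_cons sqrrD -addrA lerD2l (le_trans IH)// lerDr.
by rewrite mulrn_wge0// mulr_ge0// hnorm_ge0.
Qed.

End DirectSumNorm.

Section DirectSumOperators.
Variables (R : realType) (H K : innerType R).

Fact rowop_subproof k (A : 'I_k -> 'B(H, K)) :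
  (fun x : {ffun 'I_k -> H} => \sum_j A j (x j)) \in
    @bounded_linear R {ffun 'I_k -> H} K.
Proof.
apply/bounded_linearP; split=> [a x y|].
  rewrite scaler_sumr -big_split; apply: eq_bigr => j _.
  by rewrite !ffunE linearP.
exists (\sum_j opnorm (A j)) => x.
rewrite (le_trans (ler_hnorm_sum _ _))// mulr_suml; apply: ler_sum => j _.
have [M M0 AM] := bop_bounded (A j).
rewrite (le_trans (opnormP _ _))// ler_wpM2l ?hnorm_dsum_comp//.
by apply: lb_le_inf; [exists M | move=> N []].
Qed.
Definition rowop k (A : 'I_k -> 'B(H, K)) : 'B({ffun 'I_k -> H}, K) :=
  Bop (rowop_subproof A).

Fact mxop_subproof p q (A : 'M['B(H, K)]_(p, q)) :
  (fun x : {ffun 'I_q -> H} => [ffun i => \sum_j A i j (x j)]) \in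
    @bounded_linear R {ffun 'I_q -> H} {ffun 'I_p -> K}.
Proof.
apply/bounded_linearP; split=> [a x y|].
  apply/ffunP => i; rewrite !ffunE; exact: (linearP (rowop (A i))).
exists (\sum_i opnorm (rowop (A i))) => x.
apply: (le_trans (hnorm_dsum_le _)); rewrite mulr_suml; apply: ler_sum => i _.
by rewrite ffunE; exact: (opnormP (rowop (A i))).
Qed.
Definition mxop p q (A : 'M['B(H, K)]_(p, q)) :
    'B({ffun 'I_q -> H}, {ffun 'I_p -> K}) :=
  Bop (mxop_subproof A).

End DirectSumOperators.

Section Scalars.
Variable R : realType.
Implicit Types x y : R[i]^o.

Definition scalar_inner x y : R[i] := x * Num.conj (y : R[i]).

Fact scalar_inner_bilinear :
  bilinear_for ( *%R : R[i] -> R[i] -> R[i]) (Num.conj \; *%R) scalar_inner.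
Proof.
split=> u a x y; rewrite /scalar_inner/=.
  by rewrite mulrDl mulrA.
by rewrite rmorphD rmorphM mulrDr mulrCA.
Qed.
HB.instance Definition _ := bilinear_isBilinear.Build
  R[i] _ _ _ _ _ scalar_inner scalar_inner_bilinear.

Fact scalar_inner_hermitian x y :
  scalar_inner x y = (-1) ^+ false * Num.conj (scalar_inner y x).
Proof. by rewrite mul1r /scalar_inner rmorphM/= conjCK mulrC. Qed.
HB.instance Definition _ := isHermitianSesquilinear.Build
  R[i] _ false Num.conj scalar_inner scalar_inner_hermitian.

Fact scalar_inner_gt0 x : x != 0 -> 0 < scalar_inner x x.
Proof.
by move=> x0; rewrite /scalar_inner -normCK exprn_gt0// normr_gt0.
Qed.
HB.instance Definition _ := isDotProduct.Build
  R[i] _ scalar_inner scalar_inner_gt0.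

HB.instance Definition _ := Lmodule_hasInner.Build R R[i]^o scalar_inner.

(* norm of a scalar matrix as an operator on the Euclidean space C^m *)
Definition mxnorm m (A : 'M[R[i]]_m) : R :=
  opnorm (mxop (map_mx (fun c => c *: bop_id R[i]^o) A)).

End Scalars.

Section Ell2.
Variables (R : realType) (I : choiceType).

Definition square_summable : {pred I -> R[i]^o} := fun f =>
  `[< \esum_(al in [set: I]) (normc (f al) ^+ 2)%:E < +oo >]%E.

Lemma square_summableP (f : I -> R[i]^o) :
  reflect (\esum_(al in [set: I]) (normc (f al) ^+ 2)%:E < +oo)%E
    (f \in square_summable).
Proof. exact: asboolP. Qed.

Fact square_summable_submod : submod_closed square_summable.
Proof.
split=> [|a f g /square_summableP sf /square_summableP sg].
  by apply/square_summableP; rewrite esum1// => i _; rewrite normc0 expr0n.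
apply/square_summableP.
pose c : R := 2 * normc a ^+ 2.
have c0 : 0 <= c by rewrite mulr_ge0// sqr_ge0.
apply: (@le_lt_trans _ _ (c%:E * (\esum_(al in [set: I]) (normc (f al) ^+ 2)%:E)
    + 2%:E * (\esum_(al in [set: I]) (normc (g al) ^+ 2)%:E))%E).
  have fin (h : I -> R) : (forall i, 0 <= h i) ->
      (\esum_(al in [set: I]) (h al)%:E < +oo)%E ->
      ((\esum_(al in [set: I]) (h al)%:E) \is a fin_num)%E.
    move=> h0 hoo; rewrite ge0_fin_numE//.
    by apply: esum_ge0 => i _; rewrite lee_fin.
  have ff := fin _ (fun i => sqr_ge0 (normc (f i))) sf.
  have fg := fin _ (fun i => sqr_ge0 (normc (g i))) sg.
  rewrite -(fineK ff) -(fineK fg) -!EFinM -EFinD; apply: esum_le_fset => A.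
  apply: (@le_trans _ _ (c * (\sum_(i <- A) normc (f i) ^+ 2)
                         + 2 * (\sum_(i <- A) normc (g i) ^+ 2))).
    rewrite !mulr_sumr -big_split; apply: ler_sum => i _ /=.
    apply: (@le_trans _ _ ((normc a * normc (f i) + normc (g i)) ^+ 2)).
      rewrite ler_sqr ?nnegrE ?addr_ge0 ?mulr_ge0 ?normc_ge0//.
      by rewrite (le_trans (le_normcD _ _))// normcM.
    rewrite /c -mulrA -exprMn -mulrDr -subr_ge0.
    set u := normc a * _; set v := normc _.
    have -> : 2 * (u ^+ 2 + v ^+ 2) - (u + v) ^+ 2 = (u - v) ^+ 2 by ring.
    exact: sqr_ge0.
  by apply: lerD; rewrite ler_wpM2l// -lee_fin fineK// fset_le_esum.
by rewrite lte_add_pinfty// lte_mul_pinfty ?lee_fin// esum_ge0// => i _;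
  rewrite lee_fin sqr_ge0.
Qed.

HB.instance Definition _ :=
  GRing.isSubmodClosed.Build R[i] (I -> R[i]^o) square_summable
    square_summable_submod.

Record ell2 : Type := Ell2 {
  ell2_fun :> I -> R[i]^o;
  ell2_summable : ell2_fun \in square_summable
}.

HB.instance Definition _ := [isSub for ell2_fun].
HB.instance Definition _ := [Choice of ell2 by <:].
HB.instance Definition _ := [SubChoice_isSubLmodule of ell2 by <:].
Implicit Types f g : ell2.

Definition ell2_inner f g : R[i] := csum (fun al => f al * Num.conj (g al : R[i])).

Lemma ell2_inner_summable f g :
  abs_summable (fun al => f al * Num.conj (g al : R[i])).
Proof.
have sf := square_summableP _ (ell2_summable f).
have sg := square_summableP _ (ell2_summable g).
have := lte_add_pinfty sf sg.
rewrite -esumD//; last 2 first.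
- by move=> i _; rewrite lee_fin sqr_ge0.
- by move=> i _; rewrite lee_fin sqr_ge0.
apply: le_lt_trans; apply: le_esum => i _; rewrite -EFinD lee_fin.
have nJ (z : R[i]) : normc (Num.conj z) = normc z.
  by apply: complexI; rewrite -!normcE norm_conjC.
rewrite normcM nJ; set u := normc _; set v := normc _.
have u0 : 0 <= u by exact: normc_ge0.
have v0 : 0 <= v by exact: normc_ge0.
rewrite (@le_trans _ _ (u * v *+ 2))//; first by rewrite mulr2n lerDl mulr_ge0.
by rewrite -subr_ge0 -addrAC -sqrrB sqr_ge0.
Qed.

Fact ell2_inner_hermitian f g :
  ell2_inner f g = (-1) ^+ false * Num.conj (ell2_inner g f).
Proof.
rewrite mul1r /ell2_inner -csum_conj; last exact: ell2_inner_summable.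
by congr csum; apply/funext => i; rewrite rmorphM/= conjCK mulrC.
Qed.

Fact ell2_inner_bilinear :
  bilinear_for ( *%R : R[i] -> R[i] -> R[i]) (Num.conj \; *%R) ell2_inner.
Proof.
have L u : GRing.linear_for ( *%R : R[i] -> R[i] -> R[i]) (ell2_inner ^~ u).
  move=> a x y /=; rewrite /ell2_inner -csumP; try exact: ell2_inner_summable.
  by congr csum; apply/funext => i; rewrite mulrDl mulrA.
split=> // u a x y /=.
rewrite ell2_inner_hermitian mul1r L rmorphD rmorphM.
by rewrite [in RHS]ell2_inner_hermitian mul1r [in X in _ = _ + X]ell2_inner_hermitian mul1r.
Qed.

HB.instance Definition _ := bilinear_isBilinear.Build
  R[i] _ _ _ _ _ ell2_inner ell2_inner_bilinear.
HB.instance Definition _ := isHermitianSesquilinear.Build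
  R[i] _ false Num.conj ell2_inner ell2_inner_hermitian.

Fact ell2_inner_gt0 f : f != 0 -> 0 < ell2_inner f f.
Proof.
move=> f0; have [i fi] : exists i, f i != 0.
  apply/not_existsP => f00; move/eqP: f0; apply; apply/val_inj/funext => i /=.
  by apply/eqP; apply: contra_notT (f00 i).
rewrite /ell2_inner.
have -> : (fun al => f al * Num.conj (f al : R[i])) =
   (fun al => (normc (f al) ^+ 2)%:C%C).
  by apply/funext => al; rewrite -normCK normcE rmorphXn.
have sf := square_summableP _ (ell2_summable f).
rewrite csum_ge0//; last by move=> al; exact: sqr_ge0.
rewrite ltcR fine_gt0// sf andbT.
apply: (@lt_le_trans _ _ (\sum_(al <- [fset i]%fset) normc (f al) ^+ 2)%:E);
  last exact: fset_le_esum.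
rewrite big_seq_fset1 lte_fin exprn_gt0// lt_neqAle normc_ge0 andbT eq_sym.
by apply: contra fi => /eqP/eq0_normc ->.
Qed.
HB.instance Definition _ := isDotProduct.Build
  R[i] _ ell2_inner ell2_inner_gt0.

HB.instance Definition _ := Lmodule_hasInner.Build R ell2 ell2_inner.

Lemma hnorm_ell2 f :
  (hnorm f ^+ 2)%:E = (\esum_(al in [set: I]) (normc (f al) ^+ 2)%:E)%E.
Proof.
have sf := square_summableP _ (ell2_summable f).
have e0 : (0 <= \esum_(al in [set: I]) (normc (f al) ^+ 2)%:E)%E.
  by apply: esum_ge0 => i _; rewrite lee_fin sqr_ge0.
rewrite -[RHS]fineK ?ge0_fin_numE//; congr EFin; apply: complexI.
rewrite -innerE -csum_ge0//; last by move=> al; exact: sqr_ge0.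
congr csum; apply/funext => al.
by rewrite -normCK normcE rmorphXn.
Qed.

End Ell2.

Section Fock.
Variables (R : realType) (n : nat).

(* The full Fock space in coordinates: psi al is the coefficient of the basis
   vector e_(i_1) (x) ... (x) e_(i_k) of the k-th tensor power of H_n, where
   al = [:: i_1; ...; i_k]; the empty word corresponds to the vacuum vector 1. *)
Definition fock := ell2 R (word n).

Fact vacuum_subproof :
  (fun al : word n => (al == [::])%:R : R[i]^o) \in @square_summable R (word n).
Proof.
apply/square_summableP.
have -> : (fun al : word n => (normc ((al == [::])%:R : R[i]) ^+ 2)%:E) =
    (fun al => if al \in [set ([::] : word n)] then (1 : R)%:E else 0%E).
  apply/funext => al; case: (eqVneq al [::]) => [->|al0].
    by rewrite mem_set// normc1 expr1n.
  by rewrite memNset ?normc0 ?expr0n//; exact/eqP.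
by rewrite -esum_mkcond esum_set1// ltry.
Qed.
Definition vacuum : fock := Ell2 vacuum_subproof.

(* coefficients of e_i (x) psi *)
Definition left_creation_fun (i : 'I_n) (psi : fock) (al : word n) : R[i]^o :=
  if al is j :: be then (if j == i then psi be else 0) else 0.

Lemma left_creation_esum i psi :
  (\esum_(al in [set: word n]) (normc (left_creation_fun i psi al) ^+ 2)%:E =
   \esum_(al in [set: word n]) (normc (psi al) ^+ 2)%:E)%E.
Proof.
pose g (al : word n) := (normc (psi (behead al)) ^+ 2)%:E.
have -> : (fun al => (normc (left_creation_fun i psi al) ^+ 2)%:E) =
    (fun al => if al \in range (cons i) then g al else 0%E).
  apply/funext => -[|j be]; first by rewrite memNset ?normc0 ?expr0n//= => -[].
  rewrite /left_creation_fun; case: eqP => [->|ji].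
    by rewrite mem_set//; exists be.
  by rewrite memNset ?normc0 ?expr0n//= => -[? _ [/esym]].
by rewrite -esum_mkcond esum_image// => x y _ _ [].
Qed.

Fact left_creation_subproof i psi :
  left_creation_fun i psi \in @square_summable R (word n).
Proof.
apply/square_summableP; rewrite left_creation_esum.
exact/square_summableP/ell2_summable.
Qed.

Fact left_creation_bounded_linear i :
  (fun psi => Ell2 (left_creation_subproof i psi)) \in
    @bounded_linear R fock fock.
Proof.
apply/bounded_linearP; split=> [a f g|].
  apply/val_inj/funext => -[|j be] /=.
    by change (0 = a *: (0 : R[i]^o) + 0); rewrite scaler0 addr0.
  change ((if j == i then a *: f be + g be else 0) =
    a *: (if j == i then f be else 0) + (if j == i then g be else 0)).
  by case: eqP => // _; rewrite scaler0 addr0.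
exists 1 => psi; rewrite mul1r -ler_sqr ?nnegrE ?hnorm_ge0//.
by rewrite -lee_fin !hnorm_ell2/= left_creation_esum.
Qed.
Definition left_creation i : 'B(fock) := Bop (left_creation_bounded_linear i).

Definition nc_disc_algebra : set 'B(fock) :=
  smallest (@norm_closed_algebra R fock)
    ([set bop_id fock] `|` range left_creation).

Definition at_zero (f : 'B(fock)) : R[i] := inner (f vacuum) vacuum.

(* f(T) is the norm limit of p_j(T) for polynomials p_j with p_j(S) -> f. It is
   uniquely determined for f in the noncommutative disc algebra as soon as the
   joint numerical radius of T is at most 1; otherwise the value is arbitrary. *)
Definition nc_eval (H : innerType R) (T : 'I_n -> 'B(H)) (f : 'B(fock)) : 'B(H) :=
  xget 0 [set Y | forall p : nat -> ncpoly R n,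
    bop_cvg (fun j => ncpoly_eval left_creation (p j)) f ->
    bop_cvg (fun j => ncpoly_eval T (p j)) Y].

End Fock.

Definition joint_numerical_radius (R : realType) (H : innerType R) d
    (X : 'I_d -> 'B(H)) : \bar R :=
  ereal_sup [set (normc (csum (fun al : word d =>
                   \sum_j inner (h al) (X j (h (j :: al))))))%:E |
             h in [set h : word d -> H |
                   (\esum_(al in [set: word d]) (hnorm (h al) ^+ 2)%:E)%E = 1%E]].

(* Main.v *)
Require Import Defs.
From HB Require Import structures.
From mathcomp Require Import all_boot all_order all_algebra finmap.
From mathcomp Require Import all_classical all_reals all_analysis.
From mathcomp Require Import ring lra.
From mathcomp.real_closed Require Import complex.
From mathcomp.analysis Require Import showcase.summability.

(** For [s < 1], minimising
      [sum_al |h_al|^2 - s Re sum_{al,i} <h_al, T_i h_{g_i al}>]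
    over the families [h] with given root [h_e = x] defines a quadratic form
    [a] with [(1 - s) |x|^2 <= a x <= |x|^2] and
      [a x <= |x|^2 - s Re sum_i <x, T_i y_i> + sum_i a (y_i)]      (1)
    (a form version of Ando's characterisation of [w(T) <= 1]). Taking
    [x = sum_i s T_i y_i] in (1) shows that [(s T_i)] is a row contraction for
    the inner product [a]. Hence [W = s^2 T] has a Poisson kernel with respect
    to [a], and a noncommutative von Neumann inequality for polynomial matrices
    [G_j] without constant term, combined with (1) once more, gives
      [Re sum_j <x, G_j(W) y_j> <= |[G_j(S)]| (|x|^2 - a x + sum_j a (y_j))].
    Summed over a family indexed by words this telescopes, so that
    [w(G(W)) <= |[G_j(S)]|], and [s] tends to 1. The theorem follows by writing
    [F_j = G_j + F_j(0)]: the row [F_j(0)] has norm at most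
    [(sum_j |F_j(0)|^2)^(1/2)], and it is paid for twice, once in [|[G_j(S)]|]
    and once in [w(F(T)) <= w(G(T)) + |[F_j(0)]|]. *)

Set Implicit Arguments.
Unset Strict Implicit.
Unset Printing Implicit Defensive.
Import Order.TTheory GRing.Theory Num.Theory.
Import numFieldNormedType.Exports.
Local Open Scope classical_set_scope.
Local Open Scope ring_scope.
Import Normc.
Local Existing Instance totally_filter.

(** * Positive semidefinite forms *)

(** Everything is phrased with positive semidefinite forms and finitely supported families. A form
    stands in for the positive operator of Ando's theorem: minima and decreasing limits of forms are
    forms again, so neither square roots nor the order of operators enter, and degenerate forms such
    as the defect of a row contraction are allowed. The factor [s < 1] makes the form coercive,
    hence equivalent to the norm, so that adjoints and representing vectors come from Riesz. Two
    powers of [s] are spent: one gives a row contraction for [a], the other makes it strict, so that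
    the Poisson kernel can be truncated with a geometrically small tail. Constant terms are split
    off because the pairing to be bounded is in the inner product of [H], not in [a]: the first
    letter of a nonempty word converts [<W_i z, x>] into [a(z, v_i)] with
    [sum_i a(v_i) <= 4 (|x|^2 - a x)], and this is where the telescoping deficit originates.
    Elements of the disc algebra are approximated by polynomials at [S] and at [T] simultaneously,
    which presupposes that evaluation at [T] is bounded on polynomials. *)

Section ComplexFacts.
Variable R : realType.
Implicit Types (z w : R[i]) (r : R).

Lemma Re_conj z : complex.Re z^* = complex.Re z.
Proof. by case: z. Qed.

Lemma Re_real_mul r z : complex.Re (r%:C%C * z) = r * complex.Re z.
Proof. by case: z => a b /=; rewrite mul0r subr0. Qed.

Lemma normc_conj z : normc z^* = normc z.
Proof. by apply: complexI; rewrite -!Defs.normcE norm_conjC. Qed.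

Lemma mulc_conj z : z * z^* = (normc z ^+ 2)%:C%C.
Proof. by rewrite -normCK Defs.normcE rmorphXn. Qed.

Lemma normc_real r : normc r%:C%C = `|r|.
Proof. by rewrite /= expr0n addr0 sqrtr_sqr. Qed.

Lemma conj_realC r : (r%:C%C : R[i])^* = r%:C%C.
Proof. by apply/eqP; rewrite eq_complex /= oppr0 !eqxx. Qed.

Lemma real_complexV r : (r^-1)%:C%C = (r%:C%C)^-1 :> R[i].
Proof. exact: fmorphV. Qed.

Lemma real_complexM r r' : (r * r')%:C%C = r%:C%C * r'%:C%C :> R[i].
Proof. exact: rmorphM. Qed.

Lemma real_complexB r r' : (r - r')%:C%C = r%:C%C - r'%:C%C :> R[i].
Proof. exact: rmorphB. Qed.

Lemma normc_rotate z : exists2 u, normc u = 1 & complex.Re (u * z) = normc z.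
Proof.
have [->|z0] := eqVneq z 0.
  by exists 1; rewrite ?normc1// mulr0 normc0.
have nz : normc z != 0 by apply: contra z0 => /eqP/eq0_normc ->.
exists ((normc z)^-1%:C%C * z^*).
  by rewrite normcM normc_conj normc_real ger0_norm ?invr_ge0 ?normc_ge0 ?mulVf.
rewrite -mulrA [_^* * _]mulrC mulc_conj -rmorphM /= expr2 mulrA mulVf//.
by rewrite mul1r.
Qed.

Lemma ler_Re_normc z : complex.Re z <= normc z.
Proof. exact: le_trans (ler_norm _) (Re_le_normc _). Qed.

Lemma ler_normc_sum (I : Type) (r : seq I) (f : I -> R[i]) :
  normc (\sum_(i <- r) f i) <= \sum_(i <- r) normc (f i).
Proof.
elim/big_rec2: _ => [|i y x _ H1]; first by rewrite normc0.
by rewrite (le_trans (le_normcD _ _))// lerD2l.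
Qed.

Lemma ler_eps (x y : R) : (forall e, 0 < e -> x <= y + e) -> x <= y.
Proof. by move=> H; apply/ler_addgt0Pr. Qed.

Lemma ler_mul_eps (x y K : R) : 0 <= K ->
  (forall e, 0 < e -> x <= y + K * e) -> x <= y.
Proof.
move=> K0 H; apply: ler_eps => e e0.
have K1 : 0 < K + 1 by lra.
have := H (e / (K + 1)) (divr_gt0 e0 K1); move/le_trans; apply.
rewrite lerD2l mulrA ler_pdivrMr// mulrC ler_pM2l//; lra.
Qed.

End ComplexFacts.

Section PsdForm.
Variables (R : realType) (V : lmodType R[i]).

Record psdform := PsdForm {
  pform :> V -> V -> R[i];
  pform_linear : forall c x y z,
    pform (c *: x + y) z = c * pform x z + pform y z;
  pform_herm : forall x y, pform y x = (pform x y)^*;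
  pform_ge0 : forall x, 0 <= complex.Re (pform x x)
}.

Variable a : psdform.
Implicit Types x y z : V.

Definition qf x : R := complex.Re (a x x).

Lemma qf_ge0 x : 0 <= qf x. Proof. exact: pform_ge0. Qed.

Lemma pf0l z : a 0 z = 0.
Proof.
have := pform_linear a 1 0 0 z; rewrite scaler0 addr0 mul1r => /eqP.
by rewrite -subr_eq0 opprD addrA subrr sub0r oppr_eq0 => /eqP.
Qed.

Lemma pfDl x y z : a (x + y) z = a x z + a y z.
Proof. by have := pform_linear a 1 x y z; rewrite scale1r mul1r. Qed.

Lemma pfZl c x z : a (c *: x) z = c * a x z.
Proof. by rewrite -[c *: x]addr0 pform_linear pf0l addr0. Qed.

Lemma pfNl x z : a (- x) z = - a x z.
Proof. by rewrite -scaleN1r pfZl mulN1r. Qed.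

Lemma pf_suml (I : Type) (r : seq I) (f : I -> V) z :
  a (\sum_(i <- r) f i) z = \sum_(i <- r) a (f i) z.
Proof.
elim: r => [|i r IH]; first by rewrite !big_nil pf0l.
by rewrite !big_cons pfDl IH.
Qed.

Lemma pfDr x y z : a z (x + y) = a z x + a z y.
Proof. by rewrite pform_herm pfDl rmorphD /= -!pform_herm. Qed.

Lemma pfZr c x z : a z (c *: x) = c^* * a z x.
Proof. by rewrite pform_herm pfZl rmorphM /= -pform_herm. Qed.

Lemma pfNr x z : a z (- x) = - a z x.
Proof. by rewrite pform_herm pfNl rmorphN /= -pform_herm. Qed.

Lemma pf_sumr (I : Type) (r : seq I) (f : I -> V) z :
  a z (\sum_(i <- r) f i) = \sum_(i <- r) a z (f i).
Proof.
rewrite pform_herm pf_suml rmorph_sum; apply: eq_bigr => i _.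
exact/esym/pform_herm.
Qed.

Lemma pf_diag x : a x x = (qf x)%:C%C.
Proof.
have := pform_herm a x x; rewrite /qf; case: (a x x) => u v [] /= /eqP.
rewrite -addr_eq0 -mulr2n mulrn_eq0 /= => /eqP ->; by [].
Qed.

Lemma qf0 : qf 0 = 0. Proof. by rewrite /qf pf0l. Qed.

Lemma Re_pfC x y : complex.Re (a y x) = complex.Re (a x y).
Proof. by rewrite pform_herm Re_conj. Qed.

Lemma qfD x y : qf (x + y) = qf x + qf y + 2 * complex.Re (a x y).
Proof.
rewrite /qf pfDl !pfDr !raddfD /= (Re_pfC x y); ring.
Qed.

Lemma qfZ c x : qf (c *: x) = normc c ^+ 2 * qf x.
Proof. by rewrite /qf pfZl pfZr mulrA mulc_conj Re_real_mul. Qed.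

Lemma qfN x : qf (- x) = qf x.
Proof. by rewrite /qf pfNl pfNr opprK. Qed.

Lemma qfB x y : qf (x - y) = qf x + qf y - 2 * complex.Re (a x y).
Proof. rewrite qfD qfN pfNr raddfN /=; ring. Qed.

(** Expand [0 <= qf (l x - y)] and divide by [l]. The weight [l] stays free because each use
    balances it differently. *)
Lemma pf_amgm (l : R) x y : 0 < l ->
  2 * complex.Re (a x y) <= l * qf x + l^-1 * qf y.
Proof.
move=> l0; have := qf_ge0 (l%:C%C *: x - y).
rewrite qfB qfZ pfZl Re_real_mul normc_real real_normK ?num_real// => H.
rewrite -(ler_pM2l l0) mulrDr [l * (l^-1 * _)]mulrA divff ?gt_eqF// mul1r.
lra.
Qed.

(** Letting the weight in [pf_amgm] tend to infinity kills the remaining term in [qf y]. *)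
Lemma pf_null x y : qf x = 0 -> a x y = 0.
Proof.
move=> x0; apply: eq0_normc; apply/eqP; rewrite eq_le normc_ge0 andbT.
have [u u1 <-] := normc_rotate (a x y).
rewrite -pfZl.
have H (l : R) : 0 < l -> 2 * complex.Re (a (u *: x) y) <= l^-1 * qf y.
  by move=> /(pf_amgm (u *: x) y); rewrite qfZ x0 mulr0 mulr0 add0r.
apply: (@ler_mul_eps _ _ _ (qf y)); first exact: qf_ge0.
move=> e e0; have := H e^-1; rewrite invr_gt0 invrK => /(_ e0) h.
have q0 := qf_ge0 y.
have := mulr_ge0 (ltW e0) q0; lra.
Qed.

Lemma pf_CauchySchwarz x y : normc (a x y) ^+ 2 <= qf x * qf y.
Proof.
have [x0|x0] := eqVneq (qf x) 0.
  by rewrite pf_null// normc0 x0 mul0r expr0n.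
have xp : 0 < qf x by rewrite lt_neqAle eq_sym x0 qf_ge0.
have [u u1 E] := normc_rotate (a x y).
set t := normc (a x y) in E *.
have := qf_ge0 ((t / qf x)%:C%C *: (u *: x) - y).
rewrite qfB !qfZ pfZl pfZl Re_real_mul E u1 expr1n mul1r normc_real.
rewrite real_normK ?num_real//.
have -> : (t / qf x) ^+ 2 * qf x + qf y - 2 * (t / qf x * t) =
   qf y - t ^+ 2 / qf x by field.
by rewrite subr_ge0 ler_pdivrMr// mulrC.
Qed.

End PsdForm.

Section InnerForm.
Variables (R : realType) (H : innerType R).

Fact inner_linear (c : R[i]) (x y z : H) :
  inner (c *: x + y) z = c * inner x z + inner y z.
Proof. by rewrite linearPl. Qed.

Fact inner_herm (x y : H) : inner y x = (inner x y)^*.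
Proof. by rewrite hermC mul1r. Qed.

Fact inner_ge0 (x : H) : 0 <= complex.Re (inner x x).
Proof. by rewrite innerE sqr_ge0. Qed.

Definition inner_form : psdform H :=
  PsdForm inner_linear inner_herm inner_ge0.

Lemma qf_inner x : qf inner_form x = hnorm x ^+ 2.
Proof. by rewrite /qf /= innerE. Qed.

Lemma innerZl (c : R[i]) (x z : H) : inner (c *: x) z = c * inner x z.
Proof. exact: (pfZl inner_form). Qed.

Lemma innerZr (c : R[i]) (x z : H) : inner z (c *: x) = c^* * inner z x.
Proof. exact: (pfZr inner_form). Qed.

Lemma inner_suml (I : Type) (r : seq I) (f : I -> H) z :
  inner (\sum_(i <- r) f i) z = \sum_(i <- r) inner (f i) z.
Proof. exact: (pf_suml inner_form). Qed.

Lemma inner_sumr (I : Type) (r : seq I) (f : I -> H) z :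
  inner z (\sum_(i <- r) f i) = \sum_(i <- r) inner z (f i).
Proof. exact: (pf_sumr inner_form). Qed.

Lemma hnormN (x : H) : hnorm (- x) = hnorm x.
Proof. by rewrite -scaleN1r hnormZ normcN normc1 mul1r. Qed.

Lemma hnorm_distC (x y : H) : hnorm (x - y) = hnorm (y - x).
Proof. by rewrite -hnormN opprB. Qed.

End InnerForm.

(* The [phi v] are the coordinates of [v] in an orthonormal system whose span
   contains [vs]; they are exact against [vs] and satisfy Bessel's inequality. *)
Lemma gram_schmidt (R : realType) (V : lmodType R[i]) (d : psdform V)
    (vs : seq V) :
  exists phis : seq (V -> R[i]),
  [/\ forall phi, phi \in phis -> forall c x y, phi (c *: x + y) = c * phi x + phi y,
      forall u v, u \in vs -> d u v = \sum_(phi <- phis) phi u * (phi v)^* &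
      forall v, \sum_(phi <- phis) normc (phi v) ^+ 2 <= qf d v].
Proof.
elim: vs d => [|v0 vs IH] d.
  by exists [::]; split=> // v; rewrite big_nil qf_ge0.
have [v00|v00] := eqVneq (qf d v0) 0.
  have [phis [lphi E B]] := IH d; exists phis; split=> // u v.
  rewrite inE => /orP[/eqP->|]; last exact: E.
  rewrite pf_null//; rewrite big1_seq// => phi /= phiin.
  have /eqP := B v0; rewrite v00 => /eqP B0.
  have : normc (phi v0) ^+ 2 <= 0.
    apply: le_trans B0; rewrite (big_rem phi)//= lerDl.
    by apply: sumr_ge0 => i _; exact: sqr_ge0.
  rewrite le_eqVlt ltNge sqr_ge0 orbF sqrf_eq0 => /eqP/eq0_normc ->.
  by rewrite mul0r.
have vp : 0 < qf d v0 by rewrite lt_neqAle eq_sym v00 qf_ge0.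
(* Schur complement of [d] along [v0]: it is positive by Cauchy-Schwarz, and [v0] is null for it, so
   Bessel forces the later coordinates to vanish at [v0]. *)
pose f u w := d u w - d u v0 * d v0 w / (qf d v0)%:C%C.
have fl c x y z : f (c *: x + y) z = c * f x z + f y z.
  by rewrite /f !pform_linear; ring.
have fh x y : f y x = (f x y)^*.
  rewrite /f rmorphB !rmorphM fmorphV /= conj_realC -!pform_herm.
  by rewrite [d v0 x * _]mulrC.
have fx x : f x x = (qf d x - normc (d x v0) ^+ 2 / qf d v0)%:C%C.
  rewrite /f pf_diag [d v0 x]pform_herm mulc_conj -real_complexV.
  by rewrite -real_complexM -real_complexB.
have f0 x : 0 <= complex.Re (f x x).
  by rewrite fx /= subr_ge0 ler_pdivrMr// pf_CauchySchwarz.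
have [phis [lphi E B]] := IH (PsdForm fl fh f0).
pose s := Num.sqrt (qf d v0).
have s0 : 0 < s by rewrite sqrtr_gt0.
have ss : s ^+ 2 = qf d v0 by rewrite sqr_sqrtr// ltW.
pose phi0 u := d u v0 / s%:C%C.
have phi0E u w : phi0 u * (phi0 w)^* = d u v0 * d v0 w / (qf d v0)%:C%C.
  rewrite /phi0 rmorphM fmorphV /= conj_realC -pform_herm -ss rmorphXn /=.
  by rewrite mulrACA -invfM -expr2.
exists (phi0 :: phis); split=> [phi|u v|v].
- rewrite inE => /orP[/eqP->|/lphi//] c x y.
  by rewrite /phi0 pform_linear mulrDl mulrA.
- rewrite big_cons phi0E inE => /orP[/eqP->|].
    rewrite pf_diag [_%:C%C * _]mulrC mulfK; last first.
      by rewrite eq_complex /= (negPf v00).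
    rewrite big1_seq ?addr0// => phi /= phiin.
    have Bv := B v0.
    have q0 : qf (PsdForm fl fh f0) v0 = 0.
      rewrite /qf /= fx pf_diag normc_real ger0_norm ?qf_ge0//.
      by rewrite expr2 mulfK// subrr.
    rewrite q0 in Bv.
    have : normc (phi v0) ^+ 2 <= 0.
      apply: le_trans Bv; rewrite (big_rem phi)//= lerDl.
      by apply: sumr_ge0 => i _; exact: sqr_ge0.
    rewrite le_eqVlt ltNge sqr_ge0 orbF sqrf_eq0 => /eqP/eq0_normc ->.
    by rewrite mul0r.
  by move=> /E <- /=; rewrite /f addrC subrK.
- rewrite big_cons; have := B v; rewrite [X in _ <= X]/qf /= fx /=.
  rewrite lerBrDr addrC; apply: le_trans; rewrite lerD2r /phi0 normcM normcV.
  rewrite normc_real gtr0_norm// exprMn exprVn ss//.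
Qed.

(** * The Riesz representation for coercive forms *)

Section Riesz.
Variables (R : realType) (H : hilbertType R) (a : psdform H) (delta : R).
Hypotheses (delta_gt0 : 0 < delta)
  (a_coercive : forall x, delta * hnorm x ^+ 2 <= qf a x)
  (a_le1 : forall x, qf a x <= hnorm x ^+ 2).

Lemma exists_invS_lt (e : R) : 0 < e -> exists N, N.+1%:R^-1 < e.
Proof.
move=> e0; exists (Num.bound e^-1).
rewrite invf_plt ?posrE//; apply: lt_trans (archi_boundP _) _.
  by rewrite invr_ge0 ltW.
by rewrite ltr_nat.
Qed.

(* The representing vector minimises [qf a x - 2 Re f x]. *)
Lemma form_riesz (f : H -> R[i]) (M : R) :
  (forall c x y, f (c *: x + y) = c * f x + f y) ->
  (forall x, normc (f x) <= M * hnorm x) ->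
  exists z, forall y, f y = a y z.
Proof.
move=> fl fM.
have f0 : f 0 = 0.
  apply: eq0_normc; apply/eqP; rewrite eq_le normc_ge0 andbT.
  by rewrite (le_trans (fM 0))// hnorm0 mulr0.
have fZ c x : f (c *: x) = c * f x by rewrite -[c *: x]addr0 fl f0 addr0.
have fD x y : f (x + y) = f x + f y by have := fl 1 x y; rewrite scale1r mul1r.
pose J x := qf a x - 2 * complex.Re (f x).
have Jlb x : - (M ^+ 2 / delta) <= J x.
  have h1 := a_coercive x; have h2 := le_trans (ler_Re_normc _) (fM x).
  rewrite /J; set n := hnorm x in h1 h2 *.
  have : 0 <= delta * (n - M / delta) ^+ 2 by rewrite mulr_ge0 ?sqr_ge0 ?ltW.
  have -> : delta * (n - M / delta) ^+ 2 =
    delta * n ^+ 2 - 2 * (M * n) + M ^+ 2 / delta.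
    by field; rewrite gt_eqF.
  lra.
have hJ : has_inf (range J : set R).
  split; first by exists (J 0), 0.
  by exists (- (M ^+ 2 / delta)) => _ [x _ <-].
pose m := inf (range J).
have mJ x : m <= J x by apply: ge_inf; [exact: hJ.2 | exists x].
have ex l : exists x, J x < m + l.+1%:R^-1.
  have l0 : 0 < l.+1%:R^-1 :> R by rewrite invr_gt0.
  by have [_ [x _ <-] h] := inf_adherent l0 hJ; exists x.
pose u l := projT1 (cid (ex l)).
have uP l : J (u l) < m + l.+1%:R^-1 := projT2 (cid (ex l)).
(* Parallelogram law: [2 J x + 2 J y - 4 J ((x + y) / 2) = qf a (x - y)], and [J] is at least [m] at
   the midpoint. *)
have near2 x y e : J x < m + e -> J y < m + e ->
    delta * hnorm (x - y) ^+ 2 <= 4 * e.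
  move=> hx hy; apply: le_trans (a_coercive _) _.
  have := mJ (2^-1%:C%C *: (x + y)).
  move: hx hy; rewrite /J qfZ normc_real fZ Re_real_mul fD raddfD /= qfB qfD.
  rewrite ger0_norm ?invr_ge0//.
  lra.
(* Moving [x] along the rotated [y] by the optimal step [t] changes [J] by [- |w|^2 / qf a y]; a
   near-minimiser leaves room for a decrease of at most [e]. *)
have crit x e y : J x < m + e -> normc (a y x - f y) ^+ 2 <= e * qf a y.
  move=> hx; set w := _ - _.
  have [y0|y0] := eqVneq (qf a y) 0.
    have : y = 0.
      apply: hnorm_eq0; apply/eqP; rewrite -sqrf_eq0 eq_le sqr_ge0 andbT.
      by rewrite -(pmulr_rle0 _ delta_gt0) -y0.
    by rewrite /w => ->; rewrite pf0l f0 subrr normc0 qf0 expr0n mulr0.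
  have yp : 0 < qf a y by rewrite lt_neqAle eq_sym y0 qf_ge0.
  have [v v1 E] := normc_rotate w.
  pose t := normc w / qf a y.
  have := mJ (x + (- t)%:C%C *: (v *: y)).
  move: hx; rewrite /J qfD !qfZ normc_real normrN real_normK ?num_real//.
  rewrite v1 expr1n mul1r !fD !fZ raddfD /= !Re_real_mul pfZr pfZr conj_realC.
  rewrite Re_real_mul.
  have -> : complex.Re (v^* * a x y) = complex.Re (v * a y x).
    by rewrite pform_herm -rmorphM Re_conj.
  have Ew : complex.Re (v * a y x) = complex.Re (v * f y) + normc w.
    by rewrite -E /w mulrBr raddfB /= addrC subrK.
  rewrite Ew => h1 h2.
  have : t ^+ 2 * qf a y - 2 * t * normc w >= - e by lra.
  rewrite /t.
  have -> : (normc w / qf a y) ^+ 2 * qf a y - 2 * (normc w / qf a y) * normc w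
     = - (normc w ^+ 2 / qf a y) by field.
  by rewrite lerN2 ler_pdivrMr.
have [|z uz] := @hilbert_complete R H u.
  move=> e e0.
  have [N NP] : exists N, N.+1%:R^-1 < delta * e ^+ 2 / 4.
    by apply: exists_invS_lt; rewrite divr_gt0// mulr_gt0// exprn_gt0.
  exists N => p q Np Nq.
  have le l : (N <= l)%N -> l.+1%:R^-1 <= N.+1%:R^-1 :> R.
    by move=> ?; rewrite lef_pV2 ?posrE// ler_nat.
  have h := near2 (u p) (u q) N.+1%:R^-1
    (lt_le_trans (uP p) (lerD (lexx _) (le _ Np)))
    (lt_le_trans (uP q) (lerD (lexx _) (le _ Nq))).
  rewrite -ltr_sqr ?nnegrE ?hnorm_ge0 ?ltW// -(ltr_pM2l delta_gt0).
  apply: le_lt_trans h _; move: NP; rewrite ltr_pdivlMr// mulrC; apply.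
exists z => y; apply/eqP; rewrite eq_sym -subr_eq0; apply/eqP/eq0_normc/eqP.
rewrite -sqrf_eq0 eq_le sqr_ge0 andbT.
have q0 := qf_ge0 a y.
(* The error at [z] is a difference of two terms of square at most [e * qf a y] each:
   near-minimality of [u l], and its distance to [z]. The 4 comes from
   [(A + B)^2 <= 2 A^2 + 2 B^2]. *)
apply: (@ler_mul_eps _ _ _ (4 * qf a y)); first by rewrite mulr_ge0.
move=> e e0; rewrite add0r.
have [N NP] := exists_invS_lt e0.
move/cvgrPdist_lt : uz => /(_ (Num.sqrt e)); rewrite sqrtr_gt0 => /(_ e0).
move=> [K _ KP]; pose l := maxn K N.
have := KP l; rewrite /= leq_maxl sub0r normrN ger0_norm ?hnorm_ge0// => /(_ isT) hl.
have hl2 : hnorm (u l - z) ^+ 2 < e.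
  by rewrite -[e]sqr_sqrtr ?(ltW e0)// ltr_sqr ?nnegrE ?hnorm_ge0 ?sqrtr_ge0.
have il : l.+1%:R^-1 < e.
  by apply: le_lt_trans NP; rewrite lef_pV2 ?posrE// ler_nat ltnS leq_maxr.
have c1 := crit (u l) _ y (uP l).
have c2 := pf_CauchySchwarz a y (u l - z).
have c3 : normc (a y (u l - z)) ^+ 2 <= qf a y * e.
  apply: le_trans c2 _; rewrite ler_wpM2l//.
  exact: le_trans (a_le1 _) (ltW hl2).
have c4 : normc (a y (u l) - f y) ^+ 2 <= qf a y * e.
  by apply: le_trans c1 _; rewrite mulrC ler_wpM2l// ltW.
have -> : a y z - f y = (a y (u l) - f y) - a y (u l - z).
  by rewrite pfDr pfNr; ring.
have := le_normcD (a y (u l) - f y) (- a y (u l - z)).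
rewrite normcN => tri.
move: c3 c4 tri (normc_ge0 (a y (u l) - f y - a y (u l - z))).
set A := normc (a y (u l) - f y); set B := normc (a y _).
set D := normc _ => c3 c4 tri D0.
have : D ^+ 2 <= (A + B) ^+ 2.
  by rewrite ler_sqr ?nnegrE// (le_trans D0).
have := sqr_ge0 (A - B); rewrite sqrrB sqrrD; lra.
Qed.

(** Coercivity makes the representing vector unique, so choosing it pointwise already yields a
    linear map. *)
Lemma form_repr (f : H -> H -> R[i]) (M : R) : 0 <= M ->
  (forall c x y z, f (c *: x + y) z = c * f x z + f y z) ->
  (forall c x y z, f z (c *: x + y) = c^* * f z x + f z y) ->
  (forall x y, normc (f x y) <= M * hnorm x * hnorm y) ->
  exists Z : H -> H, (forall c x y, Z (c *: x + y) = c *: Z x + Z y) /\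
    forall x y, f y x = a y (Z x).
Proof.
move=> M0 fl fr fM.
have ex x : exists z, forall y, f y x = a y z.
  apply: (@form_riesz _ (M * hnorm x)) => [c u v|u]; first exact: fl.
  by rewrite mulrAC.
pose Z x := projT1 (cid (ex x)).
have ZP x y : f y x = a y (Z x) := projT2 (cid (ex x)) y.
exists Z; split => [c x y|//].
apply/eqP; rewrite -subr_eq0; apply/eqP/hnorm_eq0/eqP.
rewrite -sqrf_eq0 eq_le sqr_ge0 andbT -(pmulr_rle0 _ delta_gt0).
apply: le_trans (a_coercive _) _.
set D := Z _ - _; suff E y' : a y' D = 0 by rewrite /qf E.
by rewrite /D pfDr pfNr pfDr pfZr -!ZP fr subrr.
Qed.

End Riesz.

(** * Words *)

Section Words.
Variable n : nat.
Implicit Types (w : word n) (i : 'I_n).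

Fixpoint words l : seq (word n) :=
  if l is l'.+1 then flatten [seq [seq i :: w | w <- words l'] | i <- enum 'I_n]
  else [:: [::]].

Definition words_le N : seq (word n) := flatten [seq words l | l <- iota 0 N.+1].

Lemma mem_words l w : (w \in words l) = (size w == l).
Proof.
elim: l w => [|l IH] w /=; first by rewrite inE; case: w.
case: w => [|i w] /=.
  by apply/flatten_mapP => -[j _ /mapP[]].
rewrite eqSS -IH; apply/flatten_mapP/idP => [[j _ /mapP[w' h [_ ->]]]//|h].
by exists i; rewrite ?mem_enum//; apply/mapP; exists w.
Qed.

Lemma mem_words_le N w : (w \in words_le N) = (size w <= N)%N.
Proof.
apply/flatten_mapP/idP => [[l]|h].
  by rewrite mem_iota mem_words /= => h /eqP ->.
by exists (size w); rewrite ?mem_iota ?mem_words.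
Qed.

Lemma big_words_consE (V : nmodType) l (f : word n -> V) :
  \sum_(w <- words l.+1) f w = \sum_i \sum_(w <- words l) f (i :: w).
Proof.
rewrite /= big_flatten big_map big_enum /=.
by apply: eq_bigr => i _; rewrite big_map.
Qed.

Lemma uniq_words l : uniq (words l).
Proof.
elim: l => //= l IH.
have /= : uniq [seq p.1 :: p.2 | p <- [seq (i, w) | i <- enum 'I_n, w <- words l]].
  rewrite map_inj_uniq; last by move=> [i w] [j v] /= [-> ->].
  by apply: allpairs_uniq => //; rewrite ?enum_uniq// => -[? ?] [? ?].
congr (uniq _); rewrite map_flatten -map_comp; congr flatten.
by apply: eq_map => i /=; rewrite -map_comp.
Qed.

Lemma big_words_leE (V : nmodType) N (f : word n -> V) :
  \sum_(w <- words_le N) f w = \sum_(l < N.+1) \sum_(w <- words l) f w.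
Proof. by rewrite big_flatten big_map -(big_mkord xpredT (fun l => \sum_(w <- words l) f w)). Qed.

Lemma words_leS N : words_le N.+1 = words_le N ++ words N.+1.
Proof.
by rewrite /words_le -addn1 iotaD map_cat flatten_cat add0n [in LHS]/= cats0.
Qed.

Lemma uniq_words_le N : uniq (words_le N).
Proof.
elim: N => [|N IH]; first by [].
rewrite words_leS cat_uniq IH uniq_words andbT; apply/hasPn => w.
by rewrite mem_words mem_words_le => /eqP ->; rewrite ltnn.
Qed.

Lemma big_words_le0 (V : nmodType) (f : word n -> V) :
  \sum_(w <- words_le 0) f w = f [::].
Proof. by rewrite big_seq1. Qed.

Lemma big_words_leS (V : nmodType) N (f : word n -> V) :
  \sum_(w <- words_le N.+1) f w =
    \sum_(w <- words_le N) f w + \sum_(w <- words N.+1) f w.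
Proof. by rewrite !big_words_leE big_ord_recr. Qed.

Lemma big_words_le_consE (V : nmodType) N (f : word n -> V) :
  \sum_(w <- words_le N.+1) f w =
    f [::] + \sum_i \sum_(w <- words_le N) f (i :: w).
Proof.
rewrite big_words_leE big_ord_recl big_seq1; congr (_ + _).
under [RHS]eq_bigr do rewrite big_words_leE.
rewrite exchange_big /=; apply: eq_bigr => l _.
by rewrite [LHS]big_words_consE.
Qed.

(** The children of [w] in the numerical radius are the words [j :: w], so the descendants of
    [[:: i]] are the words ending in [i]. Splitting by the last letter therefore cuts a tree into
    the subtrees below its root; reversal reduces this to the split by the first letter. *)
Lemma big_words_le_rconsE (V : nmodType) N (f : word n -> V) :
  \sum_(w <- words_le N.+1) f w =
    f [::] + \sum_i \sum_(w <- words_le N) f (rcons w i).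
Proof.
have rev_inj : injective (@rev 'I_n) by apply: inv_inj; exact: revK.
have rev_perm M : perm_eq (words_le M) [seq rev w | w <- words_le M].
  apply: uniq_perm; rewrite ?(map_inj_uniq rev_inj) ?uniq_words_le// => w.
  by rewrite -{2}[w]revK (mem_map rev_inj) !mem_words_le size_rev.
rewrite (perm_big _ (rev_perm _)) big_map big_words_le_consE; congr (_ + _).
apply: eq_bigr => i _; rewrite [in RHS](perm_big _ (rev_perm _)) big_map.
by apply: eq_bigr => w _; rewrite rev_cons.
Qed.

Lemma big_words_le_supp (V : nmodType) N M (f : word n -> V) :
  (forall w, (N < size w)%N -> f w = 0) -> (N <= M)%N ->
  \sum_(w <- words_le M) f w = \sum_(w <- words_le N) f w.
Proof.
move=> f0 /subnKC <-; elim: (M - N)%N => [|k IH]; first by rewrite addn0.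
rewrite addnS big_words_leS IH [X in _ + X]big1_seq ?addr0// => w /andP[_].
by rewrite mem_words => /eqP h; apply: f0; rewrite h ltnS leq_addr.
Qed.

End Words.

(** * Ando's form *)

Section FormLimit.
Variables (R : realType) (V : lmodType R[i]).

Definition ccvg (u : nat -> R[i]) (l : R[i]) : Prop :=
  complex.Re (u N) @[N --> \oo] --> complex.Re l /\
  complex.Im (u N) @[N --> \oo] --> complex.Im l.

Lemma ccvg_unique u l l' : ccvg u l -> ccvg u l' -> l = l'.
Proof.
move=> [r i] [r' i']; apply/eqP; rewrite eq_complex.
by rewrite (cvg_unique _ r r')// (cvg_unique _ i i')// !eqxx.
Qed.

Lemma ccvgD u v l l' : ccvg u l -> ccvg v l' -> ccvg (fun N => u N + v N) (l + l').
Proof.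
move=> [r i] [r' i']; split.
  by under eq_fun do rewrite raddfD; rewrite raddfD; exact: cvgD.
by under eq_fun do rewrite raddfD; rewrite raddfD; exact: cvgD.
Qed.

Lemma ccvgZ c u l : ccvg u l -> ccvg (fun N => c * u N) (c * l).
Proof.
have ReM (z w : R[i]) : complex.Re (z * w) =
    complex.Re z * complex.Re w - complex.Im z * complex.Im w.
  by case: z w => ? ? [].
have ImM (z w : R[i]) : complex.Im (z * w) =
    complex.Re z * complex.Im w + complex.Im z * complex.Re w.
  by case: z w => ? ? [].
move=> [r i]; split.
  under eq_fun do rewrite ReM; rewrite ReM.
  by apply: cvgB; apply: cvgMr.
under eq_fun do rewrite ImM; rewrite ImM.
by apply: cvgD; apply: cvgMr.
Qed.

Lemma ccvg_conj u l : ccvg u l -> ccvg (fun N => (u N)^*) l^*.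
Proof.
have ReJ (z : R[i]) : complex.Re z^* = complex.Re z by case: z.
have ImJ (z : R[i]) : complex.Im z^* = - complex.Im z by case: z.
move=> [r i]; split.
  by under eq_fun do rewrite ReJ; rewrite ReJ.
by under eq_fun do rewrite ImJ; rewrite ImJ; exact: cvgN.
Qed.

(** Monotonicity gives convergence on the diagonal only. Polarisation carries it to real parts, and
    multiplication by [-i] to imaginary parts; the identities of a form then pass to the limit. *)
Lemma monotone_form_limit (a : nat -> psdform V) :
  (forall N x, qf (a N.+1) x <= qf (a N) x) ->
  exists b : psdform V, forall x, qf (a N) x @[N --> \oo] --> qf b x.
Proof.
move=> mono.
have cv x : exists l : R, qf (a N) x @[N --> \oo] --> l.
  eexists; apply: (@nonincreasing_cvgn _ (fun N => qf (a N) x)).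
    by apply/nonincreasing_seqP => N; exact: mono.
  by exists 0 => _ [N _ <-]; exact: qf_ge0.
pose q x := projT1 (cid (cv x)).
have qP x : qf (a N) x @[N --> \oo] --> q x := projT2 (cid (cv x)).
pose L x y := 2^-1 * (q (x + y) - q x - q y).
have LP x y : complex.Re (a N x y) @[N --> \oo] --> L x y.
  have -> : (fun N => complex.Re (a N x y)) =
     (fun N => 2^-1 * (qf (a N) (x + y) - qf (a N) x - qf (a N) y)).
    by apply/funext => N; rewrite qfD; field.
  by apply: cvgMr; apply: cvgB => //; apply: cvgB.
have ImRe N x y : complex.Im (a N x y) = complex.Re (a N (- 'i%C *: x) y).
  by rewrite pfZl; case: (a N x y) => u v /=; ring.
pose f x y : R[i] := Complex (L x y) (L (- 'i%C *: x) y).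
have fP x y : ccvg (fun N => a N x y) (f x y).
  by split => //=; under eq_fun do rewrite ImRe; exact: LP.
have fl c x y z : f (c *: x + y) z = c * f x z + f y z.
  apply: (@ccvg_unique (fun N => a N (c *: x + y) z)) => //.
  under eq_fun do rewrite pform_linear.
  by apply: ccvgD => //; apply: ccvgZ.
have fh x y : f y x = (f x y)^*.
  apply: (@ccvg_unique (fun N => a N y x)) => //.
  by under eq_fun do rewrite pform_herm; exact: ccvg_conj.
have f0 x : 0 <= complex.Re (f x x).
  have [c _] := fP x x; apply: cvgr_to_ge c _.
  by apply: nearW => N; exact: pform_ge0.
by exists (PsdForm fl fh f0) => x; have [] := fP x x.
Qed.

End FormLimit.

Definition supp_le (V : nmodType) n N (h : word n -> V) :=
  forall w, (N < size w)%N -> h w = 0.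

Section Ando.
Variables (R : realType) (H : hilbertType R) (n : nat) (T : 'I_n -> 'B(H)).
Variable s : R.
Hypotheses (s_ge0 : 0 <= s) (s_lt1 : s < 1).

Hypothesis wT : forall N h, supp_le N h ->
  complex.Re (\sum_(w <- words_le n N) \sum_j inner (h w) (T j (h (j :: w))))
  <= \sum_(w <- words_le n N) hnorm (h w) ^+ 2.

Definition energy N (h : word n -> H) : R := \sum_(w <- words_le n N)
  (hnorm (h w) ^+ 2 - s * complex.Re (\sum_j inner (h w) (T j (h (j :: w))))).

(** Only the fraction [s] of the cross terms is subtracted, so [wT] leaves the fraction [1 - s] of
    the total square sum, which contains the root. All coercivity comes from here. *)
Lemma energy_ge N h : supp_le N h -> (1 - s) * hnorm (h [::]) ^+ 2 <= energy N h.
Proof.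
move=> hN; rewrite /energy sumrB -mulr_sumr -raddf_sum /=.
have := wT hN; have := sqr_ge0 (hnorm (h [::])).
have : hnorm (h [::]) ^+ 2 <= \sum_(w <- words_le n N) hnorm (h w) ^+ 2.
  rewrite (big_rem [::]) ?mem_words_le//= lerDl.
  by apply: sumr_ge0 => w _; exact: sqr_ge0.
set A := complex.Re _; set B := \sum_(w <- _) _; set C := hnorm _ ^+ 2.
move=> CB C0 AB; have : s * A <= s * B by rewrite ler_wpM2l.
have : (1 - s) * C <= (1 - s) * B by rewrite ler_wpM2l// subr_ge0 ltW.
lra.
Qed.

(** Attainment by an actual family is recorded because it transports the lower bound [energy_ge] to
    [a]. *)
Definition min_energy N (a : psdform H) :=
  (forall x, qf a x <= hnorm x ^+ 2) /\
  (forall x, exists h, [/\ supp_le N h, h [::] = x & energy N h = qf a x]).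

(** Energy of a tree with root [x] whose subtrees at the children [y i] cost [qf a (y i)]: the
    right-hand side of (1). *)
Definition row_energy (a : psdform H) x (y : 'I_n -> H) : R :=
  hnorm x ^+ 2 - s * complex.Re (\sum_i inner x (T i (y i))) + \sum_i qf a (y i).

Lemma min_energy_coercive N a x :
  min_energy N a -> (1 - s) * hnorm x ^+ 2 <= qf a x.
Proof. by move=> [_ /(_ x)[h [hN <- <-]]]; exact: energy_ge. Qed.

Lemma min_energy0 : min_energy 0 (inner_form H).
Proof.
split=> x; first by rewrite qf_inner.
exists (fun w => if w == [::] then x else 0); split=> //; first by case.
rewrite /energy big_words_le0 eqxx qf_inner big1 ?mulr0 ?subr0// => j _.
by rewrite /= linear0 linear0r.
Qed.

(** Dynamic programming by completing the square: with [Z i] representing [(s / 2) <T_i y, x>] in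
    [a], [row_energy a x y] is minimal at [y i = Z i x], and the minimum
    [|x|^2 - sum_i qf a (Z i x)] is again a form in [x]. Coercivity at depth [N] is what makes the
    Riesz representation available. *)
Lemma min_energyS N a : min_energy N a ->
  exists a', [/\ min_energy N.+1 a',
    forall x y, qf a' x <= row_energy a x y &
    forall x, exists y, qf a' x = row_energy a x y].
Proof.
move=> Pa; have [a1 ah] := Pa.
have s1 : 0 < 1 - s by rewrite subr_gt0.
have aco x := min_energy_coercive x Pa.
have ex i : exists Z : H -> H, (forall c x y, Z (c *: x + y) = c *: Z x + Z y) /\
    forall x y, (s / 2)%:C%C * inner (T i y) x = a y (Z x).
  apply: (form_repr s1 aco a1
    (f := fun y x => (s / 2)%:C%C * inner (T i y) x)
    (M := s / 2 * opnorm (T i))) => [|c x y z|c x y z|x y].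
  - rewrite mulr_ge0 ?divr_ge0//; have [M M0 TM] := bop_bounded (T i).
    by apply: lb_le_inf; [exists M | move=> ? []].
  - by rewrite linearP linearPl /=; ring.
  - by rewrite linearPr /=; ring.
  - rewrite normcM normc_real ger0_norm ?divr_ge0//.
    rewrite -[_ * hnorm y]mulrA -(mulrA (s / 2)) ler_wpM2l ?divr_ge0//.
    apply: le_trans (inner_CauchySchwarz _ _) _; rewrite mulrA.
    by rewrite ler_wpM2r ?hnorm_ge0 ?opnormP.
pose Z i := projT1 (cid (ex i)).
have Zl i c x y : Z i (c *: x + y) = c *: Z i x + Z i y.
  by have [h _] := projT2 (cid (ex i)); exact: h.
have ZP i x y : (s / 2)%:C%C * inner (T i y) x = a y (Z i x).
  by have [_ h] := projT2 (cid (ex i)); exact: h.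
pose f x y := inner x y - \sum_i a (Z i x) (Z i y).
have rowE x y : row_energy a x y =
    hnorm x ^+ 2 - \sum_i qf a (Z i x) + \sum_i qf a (y i - Z i x).
  rewrite /row_energy -!addrA; congr (_ + _).
  rewrite -sumrN -big_split raddf_sum mulr_sumr -sumrN -big_split /=.
  apply: eq_bigr => i _; rewrite qfB -ZP Re_real_mul.
  by rewrite -(Re_pfC (inner_form H) (T i (y i)) x) /=; field.
have fq x : f x x = (hnorm x ^+ 2 - \sum_i qf a (Z i x))%:C%C.
  rewrite /f innerE real_complexB; congr (_ - _).
  by rewrite rmorph_sum /=; apply: eq_bigr => i _; rewrite pf_diag.
have treeP x : exists h, [/\ supp_le N.+1 h, h [::] = x &
    energy N.+1 h = hnorm x ^+ 2 - \sum_i qf a (Z i x)].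
  pose hh i := projT1 (cid (ah (Z i x))).
  have hhP i : [/\ supp_le N (hh i), hh i [::] = Z i x &
    energy N (hh i) = qf a (Z i x)] := projT2 (cid (ah (Z i x))).
  (* [j :: v] equals [rcons (belast j v) (last j v)]: the last letter selects the subtree, the rest
     is the position inside it. *)
  pose h (w : word n) := if w is j :: v then hh (last j v) (belast j v) else x.
  have hr w i : h (rcons w i) = hh i w.
    by case: w => [//|j v]; rewrite /h /= last_rcons belast_rcons.
  exists h; split=> //.
    case/lastP => // w i; rewrite size_rcons ltnS hr.
    by have [+ _ _] := hhP i; exact.
  rewrite /energy big_words_le_rconsE.
  have -> : \sum_i \sum_(w <- words_le n N) (hnorm (h (rcons w i)) ^+ 2 -
      s * complex.Re (\sum_j inner (h (rcons w i)) (T j (h (j :: rcons w i))))) =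
      \sum_i qf a (Z i x).
    apply: eq_bigr => i _; have [_ _ <-] := hhP i; apply: eq_bigr => w _.
    rewrite hr; congr (_ - _ * complex.Re _); apply: eq_bigr => j _.
    by rewrite -rcons_cons hr.
  have := rowE x (Z ^~ x); rewrite /row_energy.
  have -> : \sum_i inner (h [::]) (T i (h [:: i])) = \sum_i inner x (T i (Z i x)).
    by apply: eq_bigr => i _; rewrite -[[:: i]]/(rcons [::] i) hr; have [_ -> _] := hhP i.
  move=> ->; rewrite [X in _ + X]big1 ?addr0// => i _; by rewrite subrr qf0.
have fl c x y z : f (c *: x + y) z = c * f x z + f y z.
  rewrite /f linearPl /= mulrBr mulr_sumr addrACA -opprD -big_split /=.
  by congr (_ - _); apply: eq_bigr => i _; rewrite Zl pform_linear.
have fh x y : f y x = (f x y)^*.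
  rewrite /f rmorphB rmorph_sum /= -inner_herm; congr (_ - _).
  by apply: eq_bigr => i _; rewrite pform_herm.
(* Positivity is not visible from the difference defining [f]; it holds because the value is the
   energy of a family. *)
have f0 x : 0 <= complex.Re (f x x).
  rewrite fq /=; have [h [hN _ <-]] := treeP x.
  by apply: le_trans (energy_ge hN); rewrite mulr_ge0 ?sqr_ge0// ltW.
have qE x : qf (PsdForm fl fh f0) x = hnorm x ^+ 2 - \sum_i qf a (Z i x).
  by rewrite /qf /= fq.
exists (PsdForm fl fh f0); split=> [|x y|x].
- split=> x; rewrite qE; last exact: treeP.
  by rewrite gerBl sumr_ge0// => i _; exact: qf_ge0.
- by rewrite qE rowE lerDl sumr_ge0// => i _; exact: qf_ge0.
- exists (Z ^~ x); rewrite qE rowE [X in _ = _ + X]big1 ?addr0// => i _.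
  by rewrite subrr qf0.
Qed.

(** Iterate [min_energyS] from the inner product. The first step decreases the form (take [y = 0]),
    later ones because [row_energy] is monotone in its form; the inequality between consecutive
    forms becomes (1) in the limit. *)
Lemma ando_form : exists a : psdform H,
  [/\ forall x, (1 - s) * hnorm x ^+ 2 <= qf a x,
      forall x, qf a x <= hnorm x ^+ 2 &
      forall x y, qf a x <= row_energy a x y].
Proof.
pose step N (p : {a | min_energy N a}) : {a | min_energy N.+1 a} :=
  let e := cid (min_energyS (projT2 p)) in
  exist _ (projT1 e) (let: And3 h _ _ := projT2 e in h).
pose fix A N : {a | min_energy N a} :=
  if N is N'.+1 then step N' (A N') else exist _ _ min_energy0.
pose a N := projT1 (A N).
have aP N : min_energy N (a N) := projT2 (A N).
have aS N : (forall x y, qf (a N.+1) x <= row_energy (a N) x y) /\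
    (forall x, exists y, qf (a N.+1) x = row_energy (a N) x y).
  by have [_ h1 h2] := projT2 (cid (min_energyS (projT2 (A N)))); split.
have mono N x : qf (a N.+1) x <= qf (a N) x.
  elim: N x => [|N IH] x.
    rewrite /= qf_inner; have [/(_ x (fun=> 0)) + _] := aS 0%N.
    rewrite /row_energy !big1; first by rewrite mulr0 subr0 addr0.
      by move=> i _; rewrite qf0.
    by move=> i _; rewrite linear0 linear0r.
  have [_ /(_ x)[y ->]] := aS N; have [/(_ x y) h _] := aS N.+1.
  apply: le_trans h _; rewrite /row_energy lerD2l; apply: ler_sum => i _.
  exact: IH.
have [b bP] := monotone_form_limit mono.
have ble N x : qf b x <= qf (a N) x.
  have c := bP x; rewrite -(cvg_lim _ c)//.
  apply: (@nonincreasing_cvgn_ge _ (fun N => qf (a N) x)); last by apply/cvg_ex; exists (qf b x).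
  by apply/nonincreasing_seqP => M; exact: mono.
exists b; split=> [x|x|x y].
- by apply: cvgr_to_ge (bP x) _; apply: nearW => N; exact: min_energy_coercive (aP N).
- by have := ble 0%N x; rewrite /= qf_inner.
- have c : row_energy (a N) x y @[N --> \oo] --> row_energy b x y.
    apply: cvgD; first exact: cvg_cst.
    by apply: cvg_big => [|i _]; [exact: add_continuous | exact: bP].
  apply: cvgr_to_ge c _; apply: nearW => N.
  by apply: le_trans (ble N.+1 x) _; have [+ _] := aS N; exact.
Qed.

End Ando.

(** * Transfer from Fock space to row contractions *)


Lemma csum_finite (R : realType) (I : choiceType) (x : I -> R[i]) (A : seq I) :
  uniq A -> (forall i, i \notin A -> x i = 0) -> csum x = \sum_(i <- A) x i.
Proof.
move=> uA x0; apply: csum_eq; apply: cvg_near_cst.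
exists [fset i in A]%fset => //= B /= AB; rewrite /partial_sum.
rewrite -(big_seq_fsetE _ _ xpredT x) /= -(big_fset_incl _ AB) /=; last first.
  by move=> i _; rewrite !inE => /x0.
apply: perm_big; apply: uniq_perm => // i; by rewrite !inE.
Qed.

Section FockBasis.
Variables (R : realType) (n : nat).
Local Notation S := (@left_creation R n).

Lemma opword_cat (H : innerType R) (T : 'I_n -> 'B(H)) (v w : word n) x :
  opword T (v ++ w) x = opword T v (opword T w x).
Proof. by elim: v => //= i v IH; rewrite /= IH. Qed.

Definition fock_basis (w : word n) : fock R n := opword S w (vacuum R n).

Lemma opword_basis v w : opword S v (fock_basis w) = fock_basis (v ++ w).
Proof. by rewrite /fock_basis opword_cat. Qed.

Lemma fock_basisE w v : fock_basis w v = (v == w)%:R.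
Proof.
elim: w v => [|i w IH] [|j v] //=; rewrite /fock_basis /=.
rewrite eqseq_cons; case: (j == i) => //=; exact: IH.
Qed.

Lemma inner_basis (f : fock R n) w : inner f (fock_basis w) = f w.
Proof.
have -> : inner f (fock_basis w) =
    csum (fun v => f v * Num.conj (fock_basis w v : R[i])) by [].
rewrite (csum_finite (A := [:: w]))//.
  by rewrite big_seq1 fock_basisE eqxx conjC1 mulr1.
by move=> i; rewrite inE fock_basisE => /negPf ->; rewrite conjC0 mulr0.
Qed.

Lemma basis_orthonormal v w : inner (fock_basis v) (fock_basis w) = (v == w)%:R.
Proof. by rewrite inner_basis fock_basisE eq_sym. Qed.

Definition fock_comb (B : seq (word n)) (c : word n -> R[i]) : fock R n :=
  \sum_(w <- B) c w *: fock_basis w.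

Lemma inner_comb_basis (B : seq (word n)) (c : word n -> R[i]) w :
  uniq B -> w \in B -> inner (fock_basis w) (fock_comb B c) = (c w)^*.
Proof.
move=> uB wB; rewrite inner_sumr /= (bigD1_seq w)//=.
rewrite innerZr /= basis_orthonormal eqxx mulr1.
rewrite big1 ?addr0// => v vw.
by rewrite innerZr /= basis_orthonormal eq_sym (negPf vw) mulr0.
Qed.

Lemma hnorm_comb (B : seq (word n)) (c : word n -> R[i]) : uniq B ->
  hnorm (fock_comb B c) ^+ 2 = \sum_(w <- B) normc (c w) ^+ 2.
Proof.
move=> uB; rewrite -qf_inner /qf /= [X in inner X _]/fock_comb inner_suml raddf_sum.
rewrite big_seq [RHS]big_seq; apply: eq_bigr => w wB.
by rewrite innerZl /= inner_comb_basis// mulc_conj.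
Qed.

End FockBasis.

Section TransferToForms.
Variables (R : realType) (n : nat) (P Q : finType).
Variables (A : seq (word n)) (g : P -> Q -> word n -> R[i]) (C : R).
Local Notation S := (@left_creation R n).

(* Tested on finitely supported vectors only. *)
Definition fock_bound := forall (c : Q -> word n -> R[i]) N,
  \sum_p hnorm (\sum_q \sum_(v <- A)
    g p q v *: opword S v (fock_comb (words_le n N) (c q))) ^+ 2
  <= C * \sum_q \sum_(w <- words_le n N) normc (c q w) ^+ 2.

Hypotheses (C_ge0 : 0 <= C) (gC : fock_bound).

Variable l : R.
Hypothesis l_gt0 : 0 < l.

(** The left side is an inner product of Fock vectors. The hypothesis on [M] ensures that every
    [v ++ w] is among the basis words of [eta], so no coefficient is lost. *)
Lemma scalar_pairing N M (c : Q -> word n -> R[i]) (e : P -> word n -> R[i]) :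
  (forall v, v \in A -> (size v + N <= M)%N) ->
  2 * complex.Re (\sum_p \sum_q \sum_(v <- A) \sum_(w <- words_le n N)
    g p q v * (c q w * (e p (v ++ w))^*))
  <= l * (C * \sum_q \sum_(w <- words_le n N) normc (c q w) ^+ 2)
     + l^-1 * \sum_p \sum_(w <- words_le n M) normc (e p w) ^+ 2.
Proof.
move=> AM.
pose xi p := \sum_q \sum_(v <- A)
    g p q v *: opword S v (fock_comb (words_le n N) (c q)).
pose eta p := fock_comb (words_le n M) (e p).
have -> : \sum_p \sum_q \sum_(v <- A) \sum_(w <- words_le n N)
    g p q v * (c q w * (e p (v ++ w))^*) = \sum_p inner (xi p) (eta p).
  apply: eq_bigr => p _; rewrite /xi inner_suml.
  apply: eq_bigr => q _; rewrite inner_suml.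
  rewrite big_seq [RHS]big_seq; apply: eq_bigr => v vA.
  rewrite innerZl -mulr_sumr; congr (_ * _).
  rewrite [fock_comb _ (c q)]/fock_comb [opword S v _]linear_sum inner_suml.
  rewrite big_seq [RHS]big_seq; apply: eq_bigr => w.
  rewrite mem_words_le => wN.
  rewrite linearZ innerZl /= opword_basis inner_comb_basis//.
    exact: uniq_words_le.
  by rewrite mem_words_le size_cat (leq_trans _ (AM _ vA))// leq_add2l.
rewrite raddf_sum mulr_sumr /=.
apply: le_trans (_ : \sum_p (l * hnorm (xi p) ^+ 2 + l^-1 * hnorm (eta p) ^+ 2) <= _).
  by apply: ler_sum => p _; rewrite -!qf_inner; exact: (pf_amgm (inner_form _)).
rewrite big_split -!mulr_sumr; apply: lerD.
  by rewrite ler_wpM2l ?(ltW l_gt0)//; exact: gC.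
rewrite ler_wpM2l ?invr_ge0 ?(ltW l_gt0)//; apply: ler_sum => p _.
by rewrite hnorm_comb// uniq_words_le.
Qed.

(** Gram-Schmidt coordinates turn the [d]-pairing into a sum of scalar pairings, one per coordinate.
    Coordinates exact against the [Y q w] suffice: for the [X p w] Bessel's inequality goes in the
    right direction. *)
Lemma form_pairing (V : lmodType R[i]) (d : psdform V) N M
    (Y : Q -> word n -> V) (X : P -> word n -> V) :
  (forall v, v \in A -> (size v + N <= M)%N) ->
  2 * complex.Re (\sum_p \sum_q \sum_(v <- A) \sum_(w <- words_le n N)
    g p q v * d (Y q w) (X p (v ++ w)))
  <= l * (C * \sum_q \sum_(w <- words_le n N) qf d (Y q w))
     + l^-1 * \sum_p \sum_(w <- words_le n M) qf d (X p w).
Proof.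
move=> AM.
have [phis [_ E B]] := gram_schmidt d
  [seq Y q w | q <- enum Q, w <- words_le n N].
have inY q w : w \in words_le n N ->
    Y q w \in [seq Y q w | q <- enum Q, w <- words_le n N].
  by move=> h; apply/allpairsP; exists (q, w); rewrite /= mem_enum.
have -> : \sum_p \sum_q \sum_(v <- A) \sum_(w <- words_le n N)
    g p q v * d (Y q w) (X p (v ++ w)) = \sum_(phi <- phis)
    \sum_p \sum_q \sum_(v <- A) \sum_(w <- words_le n N)
    g p q v * (phi (Y q w) * (phi (X p (v ++ w)))^*).
  rewrite [RHS]exchange_big; apply: eq_bigr => p _.
  rewrite [RHS]exchange_big; apply: eq_bigr => q _.
  rewrite [RHS]exchange_big; apply: eq_bigr => v _.
  rewrite [RHS]exchange_big big_seq [RHS]big_seq; apply: eq_bigr => w wN /=.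
  by rewrite E ?inY// mulr_sumr.
rewrite raddf_sum mulr_sumr /=.
apply: le_trans (_ : \sum_(phi <- phis)
   (l * (C * \sum_q \sum_(w <- words_le n N) normc (phi (Y q w)) ^+ 2)
     + l^-1 * \sum_p \sum_(w <- words_le n M) normc (phi (X p w)) ^+ 2) <= _).
  by apply: ler_sum => phi _; exact: scalar_pairing.
rewrite big_split -!mulr_sumr; apply: lerD.
  rewrite le_eqVlt; apply/orP; left; apply/eqP; congr (_ * (_ * _)).
  rewrite exchange_big; apply: eq_bigr => q _.
  rewrite exchange_big big_seq [RHS]big_seq; apply: eq_bigr => w wN /=.
  rewrite /qf E ?inY// raddf_sum; apply: eq_bigr => phi _.
  by rewrite mulc_conj.
rewrite ler_wpM2l ?invr_ge0 ?(ltW l_gt0)// exchange_big; apply: ler_sum => p _.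
by rewrite exchange_big; apply: ler_sum => w _; exact: B.
Qed.

(** * Truncated Poisson kernel of a strict row contraction *)

Section RowContraction.
Variables (V : lmodType R[i]) (a d : psdform V) (adj : 'I_n -> V -> V) (t : R).
Hypotheses (t_ge0 : 0 <= t) (t_lt1 : t < 1)
  (tele : forall u v, a u v = d u v + \sum_i a (adj i u) (adj i v))
  (contr : forall u, \sum_i qf a (adj i u) <= t * qf a u).

(** A left fold because adjoints reverse products: the adjoint of the first letter acts first. *)
Definition adj_word u (w : word n) : V := foldl (fun v i => adj i v) u w.

(** The family [adj_word u w], measured in the defect form [d], is the Poisson kernel of [u]; the
    second sum is the cost of truncating it at length [N]. *)
Lemma telescope_le N u v : a u v =
  \sum_(w <- words_le n N) d (adj_word u w) (adj_word v w)
  + \sum_(w <- words n N.+1) a (adj_word u w) (adj_word v w).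
Proof.
have base x y : a x y = d x y + \sum_(w <- words n 1) a (adj_word x w) (adj_word y w).
  by rewrite big_words_consE tele; congr (_ + _); apply: eq_bigr => i _; rewrite big_seq1.
elim: N u v => [|N IH] u v; first by rewrite big_words_le0 -base.
rewrite big_words_le_consE [X in _ + X]big_words_consE -addrA -big_split /=.
by rewrite tele; congr (_ + _); apply: eq_bigr => i _; exact: IH.
Qed.

Lemma tail_le N u : \sum_(w <- words n N) qf a (adj_word u w) <= t ^+ N * qf a u.
Proof.
elim: N u => [|N IH] u; first by rewrite big_seq1 mul1r.
rewrite big_words_consE.
apply: le_trans (_ : \sum_i t ^+ N * qf a (adj i u) <= _).
  by apply: ler_sum => i _; exact: IH.
rewrite -mulr_sumr exprSr -mulrA ler_wpM2l ?exprn_ge0//; exact: contr.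
Qed.

Lemma defect_sum_le N u :
  \sum_(w <- words_le n N) qf d (adj_word u w) <= qf a u.
Proof.
rewrite [X in _ <= X]/qf (telescope_le N) raddfD !raddf_sum lerDl /=.
by apply: sumr_ge0 => w _; exact: qf_ge0.
Qed.

Lemma pf_normc_le (b : psdform V) x y : 2 * normc (b x y) <= qf b x + qf b y.
Proof.
have [u u1 <-] := normc_rotate (b x y).
have := pf_amgm b (u *: x) y ltr01; rewrite pfZl qfZ u1 expr1n invr1 !mul1r.
exact.
Qed.

Lemma exists_exp_lt (e : R) : 0 < e -> exists N, t ^+ N < e.
Proof.
move=> e0; have : `|t| < 1 by rewrite ger0_norm.
move=> /cvg_expr/cvgrPdist_lt/(_ e e0)[N _ /(_ N)] /=.
rewrite leqnn sub0r normrN => /(_ isT) h; exists N.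
by apply: le_lt_trans h; exact: ler_norm.
Qed.

(** The vector [sum_i e_i (x) K (x i)], where [K] is the Poisson kernel. The shift by one letter
    leaves the vacuum component zero. *)
Definition word_family (x : 'I_n -> V) (w : word n) : V :=
  if w is i :: w' then adj_word (x i) w' else 0.

(** For nonempty [v], continuing the entry of [word_family] at [v] along [w] gives its entry at
    [v ++ w]. Expanding [a] by [telescope_le] thus produces exactly the pairing of [form_pairing],
    up to tails of order [t ^ N]. *)
Lemma row_contraction_pairing (y : Q -> V) (x : P -> 'I_n -> V) :
  (forall v, v \in A -> v != [::]) ->
  2 * complex.Re (\sum_p \sum_q \sum_(v <- A)
    g p q v * a (y q) (word_family (x p) v))
  <= l * (C * \sum_q qf a (y q)) + l^-1 * \sum_p \sum_i qf a (x p i).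
Proof.
move=> A0.
(* [K * t ^+ N.+1] dominates the contribution of all tails. *)
pose K := \sum_p \sum_q \sum_(v <- A)
  normc (g p q v) * (qf a (y q) + qf a (word_family (x p) v)).
have K0 : 0 <= K.
  apply: sumr_ge0 => p _; apply: sumr_ge0 => q _; apply: sumr_ge0 => v _.
  by rewrite mulr_ge0 ?normc_ge0// addr_ge0 ?qf_ge0.
apply: (@ler_mul_eps _ _ _ K) => // e e0.
have [N NP] := exists_exp_lt e0.
have tN : t ^+ N.+1 <= e.
  rewrite exprS (le_trans _ (ltW NP))// ler_piMl ?exprn_ge0// ltW//.
pose tail q p v := \sum_(w <- words n N.+1)
  a (adj_word (y q) w) (adj_word (word_family (x p) v) w).
have tailE q p v : 2 * normc (tail q p v) <=
    e * (qf a (y q) + qf a (word_family (x p) v)).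
  apply: le_trans (_ : \sum_(w <- words n N.+1) (qf a (adj_word (y q) w) +
    qf a (adj_word (word_family (x p) v) w)) <= _).
    apply: le_trans (_ : 2 * \sum_(w <- words n N.+1) normc
       (a (adj_word (y q) w) (adj_word (word_family (x p) v) w)) <= _).
      by rewrite ler_wpM2l//; exact: ler_normc_sum.
    by rewrite mulr_sumr; apply: ler_sum => w _; exact: pf_normc_le.
  rewrite big_split mulrDr; apply: lerD; apply: le_trans (tail_le _ _) _;
    by rewrite ler_wpM2r ?qf_ge0.
have -> : \sum_p \sum_q \sum_(v <- A) g p q v * a (y q) (word_family (x p) v) =
  (\sum_p \sum_q \sum_(v <- A) \sum_(w <- words_le n N)
    g p q v * d (adj_word (y q) w) (word_family (x p) (v ++ w)))
  + \sum_p \sum_q \sum_(v <- A) g p q v * tail q p v.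
  rewrite -big_split; apply: eq_bigr => p _ /=.
  rewrite -big_split; apply: eq_bigr => q _ /=.
  rewrite -big_split big_seq [RHS]big_seq; apply: eq_bigr => v /A0 v0 /=.
  rewrite (telescope_le N) mulrDr; congr (_ + _); rewrite mulr_sumr.
  apply: eq_bigr => w _; congr (_ * d _ _).
  by case: v v0 => //= i v _; rewrite /adj_word foldl_cat.
rewrite raddfD /= mulrDr; apply: lerD; last first.
  apply: le_trans (_ : 2 * \sum_p \sum_q \sum_(v <- A) normc (g p q v * tail q p v) <= _).
    rewrite ler_wpM2l// (le_trans (ler_Re_normc _))//.
    rewrite (le_trans (ler_normc_sum _ _))//; apply: ler_sum => p _.
    rewrite (le_trans (ler_normc_sum _ _))//; apply: ler_sum => q _.
    exact: ler_normc_sum.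
  rewrite /K mulr_suml mulr_sumr; apply: ler_sum => p _.
  rewrite mulr_suml mulr_sumr; apply: ler_sum => q _.
  rewrite mulr_suml mulr_sumr; apply: ler_sum => v _.
  rewrite normcM mulrCA -mulrA ler_wpM2l ?normc_ge0//.
  by rewrite [_ * e]mulrC tailE.
pose L := (\max_(v <- A) size v)%N.
have AL v : v \in A -> (size v <= L)%N by move=> vA; exact: leq_bigmax_seq.
(* [L + N] bounds the lengths of the words [v ++ w]; the extra 1 lets the first letter be split off,
   leaving one defect sum of length [L + N] for each [x p i]. *)
have := @form_pairing _ d N (L + N).+1 (fun q => adj_word (y q))
  (fun p => word_family (x p)).
move=> H; apply: le_trans (H _) _ => [v /AL vL|].
  by rewrite -addSn leq_add2r (leq_trans vL).
apply: lerD.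
  rewrite !ler_wpM2l ?(ltW l_gt0)//; apply: ler_sum => q _.
  exact: defect_sum_le.
rewrite ler_wpM2l ?invr_ge0 ?(ltW l_gt0)//; apply: ler_sum => p _.
rewrite big_words_le_consE /= qf0 add0r; apply: ler_sum => i _.
exact: defect_sum_le.
Qed.

End RowContraction.
End TransferToForms.

(** * Polynomials without constant term *)

Section RowContractionFromAndo.
Variables (R : realType) (H : hilbertType R) (n : nat) (T : 'I_n -> 'B(H)).
Variables (s : R) (a : psdform H).
Hypotheses (s_gt0 : 0 < s) (s_lt1 : s < 1)
  (a_coercive : forall x, (1 - s) * hnorm x ^+ 2 <= qf a x)
  (a_le1 : forall x, qf a x <= hnorm x ^+ 2)
  (a_row : forall x y, qf a x <= row_energy T s a x y).

Let W i : 'B(H) := (s ^+ 2)%:C%C *: T i.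

Let s1 : 0 < 1 - s. Proof. by rewrite subr_gt0. Qed.
Let s2_gt0 : 0 < s ^+ 2. Proof. by rewrite exprn_gt0. Qed.
Let s2_lt1 : s ^+ 2 < 1. Proof. by rewrite expr_lt1 ?(ltW s_gt0). Qed.

(* The choice [x = sum_i s T_i y_i] makes the first two terms of [row_energy] cancel. *)
Lemma row_contraction_form y :
  qf a (\sum_i W i (y i)) <= s ^+ 2 * \sum_i qf a (y i).
Proof.
pose x := \sum_i s%:C%C *: T i (y i).
have -> : \sum_i W i (y i) = s%:C%C *: x.
  rewrite scaler_sumr; apply: eq_bigr => i _.
  by rewrite scalerA -real_complexM -expr2.
rewrite qfZ normc_real real_normK ?num_real// ler_wpM2l ?sqr_ge0//.
apply: le_trans (a_row x y) _; rewrite /row_energy -qf_inner -Re_real_mul.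
have -> : s%:C%C * (\sum_i inner x (T i (y i))) = inner x x.
  rewrite {2}/x inner_sumr mulr_sumr; apply: eq_bigr => i _.
  by rewrite innerZr conj_realC.
by rewrite /qf /= subrr add0r.
Qed.

Lemma form_bounded x y : normc (a x y) <= hnorm x * hnorm y.
Proof.
rewrite -ler_sqr ?nnegrE ?mulr_ge0 ?hnorm_ge0 ?normc_ge0// exprMn.
apply: le_trans (pf_CauchySchwarz _ _ _) _.
by apply: ler_pM; rewrite ?qf_ge0.
Qed.

Lemma opnorm_ge0 (K L : innerType R) (X : 'B(K, L)) : 0 <= opnorm X.
Proof.
have [M M0 XM] := bop_bounded X.
by apply: lb_le_inf; [exists M | move=> ? []].
Qed.

Lemma form_adjoint : exists adj : 'I_n -> H -> H,
  (forall i c x y, adj i (c *: x + y) = c *: adj i x + adj i y) /\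
  forall i x y, a (W i y) x = a y (adj i x).
Proof.
have ex i : exists Z : H -> H, (forall c x y, Z (c *: x + y) = c *: Z x + Z y) /\
    forall x y, a (W i y) x = a y (Z x).
  apply: (form_repr s1 a_coercive a_le1 (f := fun y x => a (W i y) x)
    (opnorm_ge0 (W i))) => [c x y z|c x y z|x y].
  - by rewrite linearP pform_linear.
  - by rewrite pfDr pfZr.
  - apply: le_trans (form_bounded _ _) _.
    by rewrite ler_wpM2r ?hnorm_ge0 ?opnormP.
exists (fun i => projT1 (cid (ex i))).
by split=> i; have [h1 h2] := projT2 (cid (ex i)).
Qed.

(** This exchanges the inner product of [H] for [a] at the price of one letter. The size of the
    [v i] is controlled by inserting multiples of them into (1), which brings in the deficit
    [|x|^2 - a x]. *)
Lemma inner_representer x : exists v : 'I_n -> H,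
  (forall i y, a y (v i) = inner (W i y) x) /\
  \sum_i qf a (v i) <= 4 * (hnorm x ^+ 2 - qf a x).
Proof.
have ex i : exists z, forall y, inner (W i y) x = a y z.
  apply: (form_riesz s1 a_coercive a_le1 (M := opnorm (W i) * hnorm x)).
    by move=> c y z; rewrite linearP linearPl.
  move=> y; apply: le_trans (inner_CauchySchwarz _ _) _.
  by rewrite mulrAC ler_wpM2r ?hnorm_ge0 ?opnormP.
pose v i := projT1 (cid (ex i)).
have vP i y : a y (v i) = inner (W i y) x.
  by have h := projT2 (cid (ex i)); rewrite -h.
exists v; split => //.
(* With [y i = r v_i] the right side of (1) is [|x|^2 - (r / s - r^2) sum_i qf a (v_i)], smallest at
   [r = 1 / (2 s)]. *)
pose r := (2 * s)^-1.
have := a_row x (fun i => r%:C%C *: v i); rewrite /row_energy.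
have -> : \sum_i qf a (r%:C%C *: v i) = r ^+ 2 * \sum_i qf a (v i).
  rewrite mulr_sumr; apply: eq_bigr => i _.
  by rewrite qfZ normc_real real_normK ?num_real.
have -> : s * complex.Re (\sum_i inner x (T i (r%:C%C *: v i))) =
    r / s * \sum_i qf a (v i).
  rewrite raddf_sum !mulr_sumr; apply: eq_bigr => i _ /=.
  rewrite linearZ /= innerZr conj_realC Re_real_mul /qf vP.
  rewrite -(Re_pfC (inner_form H) x) /= innerZl Re_real_mul.
  by rewrite /r; field; rewrite gt_eqF.
set X := \sum_i qf a (v i).
have X0 : 0 <= X by apply: sumr_ge0 => i _; exact: qf_ge0.
have -> : hnorm x ^+ 2 - r / s * X + r ^+ 2 * X =
    hnorm x ^+ 2 - X / (4 * s ^+ 2).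
  by rewrite /r; field; rewrite gt_eqF.
set D := hnorm x ^+ 2; move=> h.
have : X / (4 * s ^+ 2) <= D - qf a x by lra.
rewrite ler_pdivrMr ?mulr_gt0//.
move/le_trans; apply.
have D0 : 0 <= D - qf a x by rewrite subr_ge0 a_le1.
rewrite mulrC -mulrA ler_wpM2l// ler_piMl// ltW//.
Qed.

Lemma adjoint_contraction (adj : 'I_n -> H -> H) :
  (forall i x y, a (W i y) x = a y (adj i x)) ->
  forall u, \sum_i qf a (adj i u) <= s ^+ 2 * qf a u.
Proof.
move=> adjP u; set X := \sum_i _.
have E : X = complex.Re (a (\sum_i W i (adj i u)) u).
  rewrite pf_suml raddf_sum; apply: eq_bigr => i _ /=.
  by rewrite adjP.
have h := row_contraction_form (adj ^~ u); rewrite -/X in h.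
(* With weight [1 / s^2] the row bound turns the first term into at most [X], which is absorbed on
   the left. *)
have := pf_amgm a (\sum_i W i (adj i u)) u (l := (s ^+ 2)^-1).
rewrite invr_gt0 -E invrK => /(_ s2_gt0) h2.
have : (s ^+ 2)^-1 * qf a (\sum_i W i (adj i u)) <= X.
  by rewrite mulrC ler_pdivrMr// mulrC.
lra.
Qed.

Lemma opword_adjoint (adj : 'I_n -> H -> H) :
  (forall i x y, a (W i y) x = a y (adj i x)) ->
  forall w y u, a y (adj_word adj u w) = a (opword W w y) u.
Proof.
move=> adjP; elim=> [//|i w IH] y u /=.
by rewrite IH -adjP.
Qed.

Variables (P Q : finType) (A : seq (word n)) (g : P -> Q -> word n -> R[i]).
Variable c : R.
Hypotheses (c_gt0 : 0 < c) (A_neq0 : forall v, v \in A -> v != [::])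
  (g_bound : fock_bound A g (c ^+ 2)).

(** For a word [i :: w], [<W_i W_w y, x> = a (W_w y, v_i) = a (y, adj_word v_i w)]: the first letter
    is used by [inner_representer], the others move across as [a]-adjoints. *)
Lemma row_form_bound (y : Q -> H) (x : P -> H) :
  complex.Re (\sum_p \sum_q \sum_(v <- A)
    g p q v * inner (opword W v (y q)) (x p))
  <= c * (\sum_q qf a (y q) + \sum_p (hnorm (x p) ^+ 2 - qf a (x p))).
Proof.
have [adj [adjl adjP]] := form_adjoint.
have contr := adjoint_contraction adjP.
pose f u v := a u v - \sum_i a (adj i u) (adj i v).
have fl r u v z : f (r *: u + v) z = r * f u z + f v z.
  rewrite /f pform_linear mulrBr mulr_sumr addrACA -opprD -big_split /=.
  by congr (_ - _); apply: eq_bigr => i _; rewrite adjl pform_linear.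
have fh u v : f v u = (f u v)^*.
  rewrite /f rmorphB rmorph_sum /= -pform_herm; congr (_ - _).
  by apply: eq_bigr => i _; rewrite pform_herm.
have f0 u : 0 <= complex.Re (f u u).
  rewrite /f raddfB raddf_sum /= subr_ge0.
  by apply: le_trans (contr u) _; rewrite ler_piMl ?qf_ge0// ltW.
pose d := PsdForm fl fh f0.
have tele u v : a u v = d u v + \sum_i a (adj i u) (adj i v).
  by rewrite /= /f subrK.
pose v p := projT1 (cid (inner_representer (x p))).
have vP p i z : a z (v p i) = inner (W i z) (x p).
  by have [h _] := projT2 (cid (inner_representer (x p))); exact: h.
have vB p : \sum_i qf a (v p i) <= 4 * (hnorm (x p) ^+ 2 - qf a (x p)).
  by have [_ h] := projT2 (cid (inner_representer (x p))); exact: h.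
(* This weight balances both sides: [(2 / c) c^2 = 2 c] and [(c / 2) 4 = 2 c]. *)
have l0 : 0 < 2 / c by rewrite divr_gt0.
have := row_contraction_pairing (sqr_ge0 c) g_bound l0 (sqr_ge0 s) s2_lt1 tele
  contr y v A_neq0.
have -> : \sum_p \sum_q \sum_(w <- A) g p q w * a (y q) (word_family adj (v p) w)
  = \sum_p \sum_q \sum_(w <- A) g p q w * inner (opword W w (y q)) (x p).
  apply: eq_bigr => p _; apply: eq_bigr => q _.
  rewrite big_seq [RHS]big_seq; apply: eq_bigr => -[/A_neq0//|i w] _ /=.
  by rewrite (opword_adjoint adjP) vP.
set Re := complex.Re _; set Y := \sum_q qf a (y q).
have : \sum_p \sum_i qf a (v p i) <=
    4 * \sum_p (hnorm (x p) ^+ 2 - qf a (x p)).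
  by rewrite mulr_sumr; apply: ler_sum => p _.
set X := \sum_p (_ - _); set Z := \sum_p _ => ZX.
have -> : 2 / c * (c ^+ 2 * Y) = 2 * (c * Y) by field; rewrite gt_eqF.
rewrite invf_div => h.
have : c / 2 * Z <= 2 * (c * X).
  have := ler_wpM2l (ltW c_gt0) ZX; lra.
lra.
Qed.

End RowContractionFromAndo.

Section PolynomialBound.
Variables (R : realType) (H : hilbertType R) (n : nat) (T : 'I_n -> 'B(H)).
Hypothesis wT : forall N (h : word n -> H), supp_le N h ->
  complex.Re (\sum_(w <- words_le n N) \sum_j inner (h w) (T j (h (j :: w))))
  <= \sum_(w <- words_le n N) hnorm (h w) ^+ 2.

Variables (k : nat) (P : finType) (A : seq (word n)).
Variable c : R.
Hypotheses (c_gt0 : 0 < c) (A_neq0 : forall v, v \in A -> v != [::]).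
Implicit Types (g : P -> 'I_k * P -> word n -> R[i]) (h : word k -> P -> H).

Lemma opword_scale (r : R[i]) (w : word n) x :
  opword (fun i => r *: T i) w x = r ^+ size w *: opword T w x.
Proof.
elim: w => [|i w IH] /=; first by rewrite scale1r.
transitivity (r *: T i (r ^+ size w *: opword T w x)); first by rewrite -IH.
by rewrite linearZ /= scalerA -exprS.
Qed.

Lemma scaled_polynomial_bound g N h (s : R) : 0 < s -> s < 1 ->
  fock_bound A g (c ^+ 2) ->
  (forall w, (N < size w)%N -> forall p, h w p = 0) ->
  complex.Re (\sum_(w <- words_le k N) \sum_p \sum_q \sum_(v <- A)
    g p q v * inner (opword (fun i => (s ^+ 2)%:C%C *: T i) v (h (q.1 :: w) q.2)) (h w p))
  <= c * \sum_(w <- words_le k N) \sum_p hnorm (h w p) ^+ 2.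
Proof.
move=> s0 s1 gb hN.
have [a [aco a1 arow]] := ando_form (ltW s0) s1 wT.
pose B w := \sum_p qf a (h w p).
rewrite raddf_sum /=.
apply: le_trans (_ : \sum_(w <- words_le k N) c * (\sum_j B (j :: w) +
    \sum_p (hnorm (h w p) ^+ 2 - qf a (h w p))) <= _).
  apply: ler_sum => w _.
  apply: le_trans (row_form_bound s0 s1 aco a1 arow c_gt0 A_neq0 gb
    (fun q => h (q.1 :: w) q.2) (h w)) _.
  by rewrite /B pair_bigA /=.
rewrite -mulr_sumr ler_wpM2l ?(ltW c_gt0)// big_split /= -lerBrDr.
rewrite -sumrB exchange_big /=.
(* The words [j :: w] run through all nonempty words of length at most [N + 1], and [B] vanishes at
   length [N + 1]; what survives the cancellation is [- B [::] <= 0]. *)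
have := big_words_le_consE N B.
rewrite big_words_leS [X in _ + X]big1_seq ?addr0; last first.
  move=> w /andP[_]; rewrite mem_words => /eqP wN; rewrite /B big1// => p _.
  by rewrite hN ?qf0// wN.
move=> E; have B0 : 0 <= B [::] by apply: sumr_ge0 => p _; exact: qf_ge0.
rewrite (le_trans (_ : _ <= \sum_(w <- words_le k N) B w))//.
  by rewrite E lerDr.
by rewrite le_eqVlt; apply/orP; left; apply/eqP; apply: eq_bigr => w _;
  rewrite sumrB opprB addrC subrK.
Qed.

(** The bound for the scaled tuple does not involve [s], and its left side is a polynomial in [s];
    let [s] tend to 1 from below. *)
Lemma Re_polynomial_bound g N h : fock_bound A g (c ^+ 2) ->
  (forall w, (N < size w)%N -> forall p, h w p = 0) ->
  complex.Re (\sum_(w <- words_le k N) \sum_p \sum_q \sum_(v <- A)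
    g p q v * inner (opword T v (h (q.1 :: w) q.2)) (h w p))
  <= c * \sum_(w <- words_le k N) \sum_p hnorm (h w p) ^+ 2.
Proof.
move=> gb hN; set K := c * _.
pose r w p q v := complex.Re (g p q v * inner (opword T v (h (q.1 :: w) q.2)) (h w p)).
pose F (s : R) := \sum_(w <- words_le k N) \sum_p \sum_q \sum_(v <- A)
  s ^+ (2 * size v) * r w p q v.
have FK s : 0 < s -> s < 1 -> F s <= K.
  move=> s0 s1; apply: le_trans (scaled_polynomial_bound s0 s1 gb hN).
  rewrite raddf_sum le_eqVlt; apply/orP; left; apply/eqP.
  apply: eq_bigr => w _; rewrite raddf_sum; apply: eq_bigr => p _ /=.
  rewrite raddf_sum; apply: eq_bigr => q _ /=.
  rewrite raddf_sum; apply: eq_bigr => v _ /=.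
  by rewrite opword_scale innerZl mulrCA -rmorphXn /= Re_real_mul exprM.
have F1 : F 1 = complex.Re (\sum_(w <- words_le k N) \sum_p \sum_q \sum_(v <- A)
    g p q v * inner (opword T v (h (q.1 :: w) q.2)) (h w p)).
  rewrite raddf_sum; apply: eq_bigr => w _; rewrite raddf_sum /=.
  apply: eq_bigr => p _; rewrite raddf_sum /=; apply: eq_bigr => q _.
  rewrite raddf_sum /=; apply: eq_bigr => v _.
  by rewrite expr1n mul1r.
rewrite -F1.
have cF : F s @[s --> 1^'-] --> F 1.
  apply: cvg_at_left_filter; rewrite /F.
  apply: cvg_big => [|w _]; first exact: add_continuous.
  apply: cvg_big => [|p _]; first exact: add_continuous.
  apply: cvg_big => [|q _]; first exact: add_continuous.
  apply: cvg_big => [|v _]; first exact: add_continuous.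
  by apply: cvgMl; exact: exprn_continuous.
apply: cvgr_to_le cF _; near=> s; apply: FK.
  by near: s; exact: nbhs_left_gt.
by near: s; exact: nbhs_left_lt.
Unshelve. all: by end_near.
Qed.

Lemma polynomial_bound g N h : fock_bound A g (c ^+ 2) ->
  (forall w, (N < size w)%N -> forall p, h w p = 0) ->
  normc (\sum_(w <- words_le k N) \sum_p \sum_q \sum_(v <- A)
    g p q v * inner (opword T v (h (q.1 :: w) q.2)) (h w p))
  <= c * \sum_(w <- words_le k N) \sum_p hnorm (h w p) ^+ 2.
Proof.
move=> gb hN; set z := \sum_(w <- _) _; have [u u1 <-] := normc_rotate z.
have -> : u * z = \sum_(w <- words_le k N) \sum_p \sum_q \sum_(v <- A)
    (u * g p q v) * inner (opword T v (h (q.1 :: w) q.2)) (h w p).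
  rewrite mulr_sumr; apply: eq_bigr => w _; rewrite mulr_sumr.
  apply: eq_bigr => p _; rewrite mulr_sumr; apply: eq_bigr => q _.
  by rewrite mulr_sumr; apply: eq_bigr => v _; rewrite mulrA.
apply: (@Re_polynomial_bound (fun p q v => u * g p q v)) => // e M.
apply: le_trans (gb e M); apply: ler_sum => p _.
rewrite le_eqVlt; apply/orP; left; apply/eqP; congr (_ ^+ 2).
rewrite -[RHS]mul1r -u1 -hnormZ; congr hnorm; rewrite scaler_sumr.
apply: eq_bigr => q _; rewrite scaler_sumr; apply: eq_bigr => v _.
by rewrite scalerA.
Qed.

End PolynomialBound.

(** * Joint numerical radius, operator norms and the disc algebra *)

Lemma mem_fset_seq (I : choiceType) (A : seq I) i :
  (i \in [fset i in A]%fset) = (i \in A).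
Proof. by rewrite !inE. Qed.

Section JointNumericalRadius.
Variables (R : realType) (L : innerType R) (d : nat) (X : 'I_d -> 'B(L)).
Implicit Types h : word d -> L.

Lemma sum_subset_le (I : eqType) (A B : seq I) (x : I -> R) :
  uniq A -> {subset A <= B} -> (forall i, 0 <= x i) ->
  \sum_(i <- A) x i <= \sum_(i <- B) x i.
Proof.
elim: A B => [|i A IH] B /=; first by move=> _ _ x0; rewrite big_nil sumr_ge0.
move=> /andP[iA uA] AB x0; have iB : i \in B := AB i (mem_head _ _).
rewrite big_cons (big_rem i iB) /= lerD2l; apply: IH => // j jA.
have jB : j \in B by apply: AB; rewrite inE jA orbT.
have := perm_mem (perm_to_rem iB) j; rewrite jB inE => /esym/orP[/eqP ji|//].
by rewrite -ji jA in iA.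
Qed.

Lemma esum_finite (I : choiceType) (x : I -> R) (A : seq I) :
  uniq A -> (forall i, 0 <= x i) -> (forall i, i \notin A -> x i = 0) ->
  (\esum_(i in [set: I]) (x i)%:E = (\sum_(i <- A) x i)%:E)%E.
Proof.
move=> uA xge0 x0; apply/eqP; rewrite eq_le; apply/andP; split.
  apply: esum_le_fset => B.
  have -> : \sum_(i <- B) x i = \sum_(i <- B | i \in A) x i.
    rewrite [LHS](bigID (fun i => i \in A)) /= [X in _ + X]big1 ?addr0//.
  rewrite -big_filter; apply: sum_subset_le => //.
    by rewrite filter_uniq.
  by move=> i; rewrite mem_filter => /andP[].
apply: le_trans (fset_le_esum x [fset i in A]%fset).
rewrite lee_fin; apply: sum_subset_le => // i iA.
by rewrite -[_ \in _]/(i \in [fset i in A]%fset) mem_fset_seq.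
Qed.

Lemma joint_numerical_radius_finite N h :
  (joint_numerical_radius X <= 1%:E)%E -> supp_le N h ->
  normc (\sum_(w <- words_le d N) \sum_j inner (h w) (X j (h (j :: w))))
  <= \sum_(w <- words_le d N) hnorm (h w) ^+ 2.
Proof.
move=> X1 hN; set S := \sum_(w <- _) hnorm _ ^+ 2; set z := \sum_(w <- _) _.
have S0 : 0 <= S by apply: sumr_ge0 => w _; exact: sqr_ge0.
have [Sz|Sn] := eqVneq S 0.
  have h0 w : h w = 0.
    have [wN|/hN//] := leqP (size w) N.
    apply: hnorm_eq0; apply/eqP; rewrite -sqrf_eq0 eq_le sqr_ge0 andbT.
    rewrite -Sz /S (bigD1_seq w) ?mem_words_le ?uniq_words_le//= lerDl.
    by apply: sumr_ge0 => v _; exact: sqr_ge0.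
  rewrite /z big1 ?normc0// => w _; rewrite big1// => j _.
  by rewrite h0 linear0l.
have Sp : 0 < S by rewrite lt_neqAle eq_sym Sn.
pose r := (Num.sqrt S)^-1.
have r2 : r ^+ 2 = S^-1 by rewrite exprVn sqr_sqrtr.
pose h' w := r%:C%C *: h w.
have h'N w : (N < size w)%N -> h' w = 0 by move=> /hN hw; rewrite /h' hw scaler0.
have hh' w : hnorm (h' w) ^+ 2 = S^-1 * hnorm (h w) ^+ 2.
  by rewrite hnormZ exprMn normc_real real_normK ?num_real// r2.
have out w : w \notin words_le d N -> h' w = 0.
  by rewrite mem_words_le -ltnNge; exact: h'N.
have : ((normc (csum (fun al : word d => \sum_j inner (h' al) (X j (h' (j :: al))))))%:E
    <= 1%:E)%E.
  apply: le_trans X1; apply: ereal_sup_ubound; exists h' => //=.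
  rewrite (esum_finite (uniq_words_le d N)) => [|w|w /out ->].
  - by under eq_bigr do rewrite hh'; rewrite -mulr_sumr mulVf.
  - exact: sqr_ge0.
  - by rewrite hnorm0 expr0n.
rewrite lee_fin (csum_finite (uniq_words_le d N)); last first.
  by move=> w /out ->; rewrite big1// => j _; rewrite linear0l.
have -> : \sum_(w <- words_le d N) \sum_j inner (h' w) (X j (h' (j :: w))) =
    (S^-1)%:C%C * z.
  rewrite mulr_sumr; apply: eq_bigr => w _; rewrite mulr_sumr; apply: eq_bigr => j _.
  by rewrite /h' linearZ /= innerZl innerZr conj_realC mulrA -real_complexM -expr2 r2.
by rewrite normcM normc_real gtr0_norm ?invr_gt0// mulrC ler_pdivrMr// mul1r.
Qed.

Lemma joint_numerical_radius_le (M : R) : 0 <= M ->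
  (forall N h, supp_le N h ->
    normc (\sum_(w <- words_le d N) \sum_j inner (h w) (X j (h (j :: w))))
    <= M * \sum_(w <- words_le d N) hnorm (h w) ^+ 2) ->
  (joint_numerical_radius X <= M%:E)%E.
Proof.
move=> M0 XM; apply: ge_ereal_sup => _ [h /= h1 <-]; rewrite lee_fin.
have hle N : \sum_(w <- words_le d N) hnorm (h w) ^+ 2 <= 1.
  rewrite -lee_fin -h1.
  apply: le_trans (fset_le_esum _ [fset w in words_le d N]%fset).
  rewrite lee_fin; apply: sum_subset_le => [||w]; first exact: uniq_words_le.
    by move=> w wN; rewrite -[_ \in _]/(w \in [fset w in words_le d N]%fset) mem_fset_seq.
  exact: sqr_ge0.
pose f (w : word d) := \sum_j inner (h w) (X j (h (j :: w))).
(* Needed to identify [csum f] with the limit of its partial sums. In the bound [K (d + 1)] each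
   [h w] is counted once for each of its [d] children and at most once as a child. *)
have fs : abs_summable f.
  pose K := \sum_j opnorm (X j).
  have K0 : 0 <= K by apply: sumr_ge0 => j _; exact: opnorm_ge0.
  apply: (@le_lt_trans _ _ (K * (d%:R + 1))%:E); last exact: ltry.
  apply: esum_le_fset => A; pose N := (\max_(w <- A) size w)%N.
  apply: le_trans (_ : \sum_(w <- words_le d N) normc (f w) <= _).
    apply: sum_subset_le => [||w]; [exact: fset_uniq | | exact: normc_ge0].
    by move=> w wA; rewrite mem_words_le; apply: leq_bigmax_seq.
  apply: le_trans (_ : \sum_(w <- words_le d N)
     K * \sum_(j < d) (hnorm (h w) ^+ 2 + hnorm (h (j :: w)) ^+ 2) <= _).
    apply: ler_sum => w _; apply: le_trans (ler_normc_sum _ _) _.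
    rewrite mulr_sumr; apply: ler_sum => j _.
    apply: le_trans (inner_CauchySchwarz _ _) _.
    have h2 := opnormP (X j) (h (j :: w)).
    have jK : opnorm (X j) <= K.
      by rewrite /K (bigD1 j)//= lerDl sumr_ge0// => i _; exact: opnorm_ge0.
    apply: le_trans (_ : hnorm (h w) * (K * hnorm (h (j :: w))) <= _).
      rewrite ler_wpM2l ?hnorm_ge0// (le_trans h2)// ler_wpM2r ?hnorm_ge0//.
    rewrite mulrCA ler_wpM2l//.
    have := sqr_ge0 (hnorm (h w) - hnorm (h (j :: w))); rewrite sqrrB.
    have := mulr_ge0 (hnorm_ge0 (h w)) (hnorm_ge0 (h (j :: w))); lra.
  rewrite -mulr_sumr ler_wpM2l//.
  under eq_bigr do rewrite big_split /= sumr_const card_ord -mulr_natl.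
  rewrite big_split /= -mulr_sumr; apply: lerD.
    by rewrite ler_piMr.
  have := hle N.+1; rewrite big_words_le_consE exchange_big /=; apply: le_trans.
  by rewrite lerDr sqr_ge0.
have := abs_summable_cvg fs; move=> /cvgrPdist_lt cv.
apply: ler_eps => e e0.
have [|A _ AP] := cv e%:C%C; first by rewrite ltcE /= eqxx.
pose N := (\max_(w <- A) size w)%N.
have := AP [fset w in words_le d N]%fset; rewrite /= => H.
have {H} : `|csum f - partial_sum (f : word d -> R[i]^o) [fset w in words_le d N]%fset| < e%:C%C.
  apply: H; apply/fsubsetP => w wA; rewrite mem_fset_seq mem_words_le.
  exact: leq_bigmax_seq.
have -> : partial_sum (f : word d -> R[i]^o) [fset w in words_le d N]%fset =
    \sum_(w <- words_le d N) f w.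
  rewrite /partial_sum -(big_seq_fsetE _ _ xpredT f) /=; apply: perm_big.
  by apply: uniq_perm; rewrite ?fset_uniq ?uniq_words_le// => w; exact: mem_fset_seq.
rewrite Defs.normcE ltcR => H.
have -> : csum f = (csum f - \sum_(w <- words_le d N) f w) +
  \sum_(w <- words_le d N) f w by rewrite subrK.
apply: le_trans (le_normcD _ _) _; rewrite addrC; apply: lerD (ltW H).
(* The cut is at [N + 1] because the summands with [size w = N] involve [h (j :: w)]; at length
   [N + 1] the summands of [h'] vanish. *)
pose h' w := if (size w <= N.+1)%N then h w else 0.
have h'N : supp_le N.+1 h' by move=> w; rewrite ltnNge /h' => /negPf ->.
have := XM _ _ h'N; rewrite big_words_leS.
have -> : \sum_(w <- words_le d N) \sum_j inner (h' w) (X j (h' (j :: w))) =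
    \sum_(w <- words_le d N) f w.
  rewrite big_seq [RHS]big_seq; apply: eq_bigr => w; rewrite mem_words_le => wN.
  by apply: eq_bigr => j _; rewrite /h' /= ltnS wN (leq_trans wN).
rewrite [X in _ + X]big1_seq ?addr0; last first.
  move=> w /andP[_]; rewrite mem_words => /eqP wN; rewrite big1// => j _.
  by rewrite [h' (_ :: _)]h'N ?linear0 ?linear0r//= wN.
move/le_trans; apply; rewrite ler_piMr//.
apply: le_trans (hle N.+1); rewrite big_seq [X in _ <= X]big_seq.
by apply: ler_sum => w; rewrite mem_words_le /h' => ->.
Qed.

End JointNumericalRadius.

Section OperatorNorm.
Variable R : realType.
Implicit Types H K L : innerType R.

Lemma bopP H K (X Y : 'B(H, K)) : (forall x, X x = Y x) -> X = Y.
Proof. by move=> XY; apply/val_inj/funext. Qed.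

Lemma opnorm_le H K (X : 'B(H, K)) M :
  0 <= M -> (forall x, hnorm (X x) <= M * hnorm x) -> opnorm X <= M.
Proof.
move=> M0 XM; apply: ge_inf; last by split.
by exists 0 => N [].
Qed.

Lemma opnorm0 H K : opnorm (0 : 'B(H, K)) = 0.
Proof.
apply/eqP; rewrite eq_le opnorm_ge0 andbT; apply: opnorm_le => // x.
by rewrite hnorm0 mul0r.
Qed.

Lemma opnormD H K (X Y : 'B(H, K)) : opnorm (X + Y) <= opnorm X + opnorm Y.
Proof.
apply: opnorm_le => [|x]; first by rewrite addr_ge0 ?opnorm_ge0.
by rewrite (le_trans (ler_hnormD _ _))// mulrDl lerD ?opnormP.
Qed.

Lemma opnormZ_le H K c (X : 'B(H, K)) : opnorm (c *: X) <= normc c * opnorm X.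
Proof.
apply: opnorm_le => [|x]; first by rewrite mulr_ge0 ?normc_ge0 ?opnorm_ge0.
by rewrite hnormZ -mulrA ler_wpM2l ?normc_ge0 ?opnormP.
Qed.

Lemma opnorm_distC H K (X Y : 'B(H, K)) : opnorm (X - Y) = opnorm (Y - X).
Proof.
have le (Z : 'B(H, K)) : opnorm (- Z) <= opnorm Z.
  by rewrite -scaleN1r (le_trans (opnormZ_le _ _))// normcN normc1 mul1r.
by apply/eqP; rewrite eq_le -{1}[X - Y]opprB le -[Y - X]opprB le.
Qed.

Lemma opnorm_triangle H K (X Y Z : 'B(H, K)) :
  opnorm (X - Z) <= opnorm (X - Y) + opnorm (Y - Z).
Proof. by rewrite (le_trans _ (opnormD _ _))// addrA subrK. Qed.

Lemma opnorm_comp H K L (X : 'B(K, L)) (Y : 'B(H, K)) :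
  opnorm (bop_comp X Y) <= opnorm X * opnorm Y.
Proof.
apply: opnorm_le => [|x]; first by rewrite mulr_ge0 ?opnorm_ge0.
by rewrite /= (le_trans (opnormP _ _))// -mulrA ler_wpM2l ?opnorm_ge0 ?opnormP.
Qed.

Lemma bop_sumE H K (I : Type) (r : seq I) (X : I -> 'B(H, K)) x :
  (\sum_(i <- r) X i) x = \sum_(i <- r) X i x.
Proof. by elim: r => [|i r IH]; rewrite ?big_nil// !big_cons -IH. Qed.

End OperatorNorm.

(** * Noncommutative polynomials and their density in the disc algebra *)

Section NcPoly.
Variables (R : realType) (n : nat).
Implicit Types p q : ncpoly R n.

(** [L] is chosen before [H] and [T] because one expansion must serve on Fock space and on [H]; any
    larger [M] is allowed so that several polynomials can share a word list. *)
Lemma ncpoly_eval_words p : exists L, forall M, (L <= M)%N ->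
  forall (H : innerType R) (T : 'I_n -> 'B(H)),
  ncpoly_eval T p = \sum_(w <- words_le n M) p w *: opword T w.
Proof.
exists (\max_(w <- finsupp p) size w)%N => M LM H T.
have sub w : w \in finsupp p -> w \in words_le n M.
  by move=> wp; rewrite mem_words_le (leq_trans _ LM)//; exact: leq_bigmax_seq.
rewrite [RHS](bigID (fun w => w \in finsupp p)) /= [X in _ + X]big1 ?addr0.
  rewrite -big_filter; apply: perm_big; apply: uniq_perm; rewrite ?fset_uniq//.
    by rewrite filter_uniq// uniq_words_le.
  move=> w; rewrite mem_filter; case wp: (w \in finsupp p) => //=.
  by rewrite sub.
by move=> w; rewrite memNfinsupp => /eqP ->; rewrite scale0r.
Qed.

Lemma ncpoly_of_coef L (g : word n -> R[i]) : exists p,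
  forall (H : innerType R) (T : 'I_n -> 'B(H)),
  ncpoly_eval T p = \sum_(w <- words_le n L) g w *: opword T w.
Proof.
pose p : ncpoly R n := [fsfun w in [fset w in words_le n L]%fset => g w].
exists p => H T; have [M MP] := ncpoly_eval_words p.
rewrite (MP (maxn L M)) ?leq_maxr//.
rewrite (big_words_le_supp _ (leq_maxl L M)); last first.
  move=> w Lw; by rewrite /p fsfunE mem_fset_seq mem_words_le leqNgt Lw scale0r.
rewrite big_seq [RHS]big_seq; apply: eq_bigr => w wL.
by rewrite /p fsfunE mem_fset_seq wL.
Qed.

Lemma ncpoly_lin c p q : exists r,
  forall (H : innerType R) (T : 'I_n -> 'B(H)),
  ncpoly_eval T r = c *: ncpoly_eval T p + ncpoly_eval T q.
Proof.
have [L LP] := ncpoly_eval_words p; have [M MP] := ncpoly_eval_words q.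
have [r rP] := ncpoly_of_coef (maxn L M) (fun w => c * p w + q w).
exists r => H T; rewrite rP (LP (maxn L M)) ?leq_maxl// (MP (maxn L M)) ?leq_maxr//.
rewrite scaler_sumr -big_split; apply: eq_bigr => w _.
by rewrite scalerA scalerDl.
Qed.

Lemma ncpoly_sum (I : Type) (s : seq I) (c : I -> R[i]) (u : I -> word n) :
  exists r, forall (H : innerType R) (T : 'I_n -> 'B(H)),
  ncpoly_eval T r = \sum_(i <- s) c i *: opword T (u i).
Proof.
elim: s => [|i s [q qP]].
  have [r rP] := ncpoly_of_coef 0 (fun=> 0); exists r => H T.
  by rewrite rP big_nil big1// => w _; rewrite scale0r.
have [p pP] := ncpoly_of_coef (size (u i)) (fun w => (w == u i)%:R).
have [r rP] := ncpoly_lin (c i) p q; exists r => H T.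
rewrite rP qP big_cons pP; congr (_ *: _ + _).
rewrite (bigD1_seq (u i)) ?uniq_words_le ?mem_words_le//= eqxx scale1r.
by rewrite big1 ?addr0// => w /negPf ->; rewrite scale0r.
Qed.

Lemma ncpoly_mul p q : exists r,
  forall (H : innerType R) (T : 'I_n -> 'B(H)),
  ncpoly_eval T r = bop_comp (ncpoly_eval T p) (ncpoly_eval T q).
Proof.
have [r rP] := ncpoly_sum [seq (v, w) | v <- finsupp p, w <- finsupp q]
  (fun z => p z.1 * q z.2) (fun z => z.1 ++ z.2).
exists r => H T; rewrite rP big_allpairs; apply: bopP => x.
rewrite bop_sumE /= /ncpoly_eval bop_sumE; apply: eq_bigr => v _.
rewrite bop_sumE [in RHS]bop_sumE.
rewrite -[RHS]/(p v *: opword T v _) linear_sum scaler_sumr; apply: eq_bigr => w _.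
rewrite -[LHS]/(_ *: opword T (v ++ w) x) opword_cat.
by rewrite -[(q w *: opword T w) x]/(q w *: opword T w x) linearZ /= scalerA.
Qed.

Local Notation S := (@left_creation R n).

(** The norm limits of polynomials form a norm closed algebra containing the generators, hence
    contain the smallest such algebra. *)
Lemma disc_algebra_approx f : nc_disc_algebra f -> forall e, 0 < e ->
  exists p, opnorm (ncpoly_eval S p - f) < e.
Proof.
pose C : set 'B(fock R n) :=
  [set f | forall e, 0 < e -> exists p, opnorm (ncpoly_eval S p - f) < e].
have gen w : C (opword S w).
  move=> e e0; have [p pP] := ncpoly_sum [:: tt] (fun=> 1) (fun=> w).
  by exists p; rewrite pP big_seq1 scale1r subrr opnorm0.
suff : @nc_disc_algebra R n `<=` C by move=> h /h.
apply: smallest_sub; last first.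
  move=> X [->|[i _ <-]]; first exact: (gen [::]).
  have -> : S i = opword S [:: i] by exact: bopP.
  exact: gen.
split=> [c X Y CX CY e e0|X Y CX CY e e0|X Y CX XY e e0].
- have c0 : 0 < normc c + 1 by rewrite ltr_wpDl ?normc_ge0.
  have [p pe] := CX (e / 2 / (normc c + 1)) (divr_gt0 (divr_gt0 e0 (ltr0Sn _ _)) c0).
  have [q qe] := CY (e / 2) (divr_gt0 e0 (ltr0Sn _ _)).
  have [r rP] := ncpoly_lin c p q; exists r; rewrite rP.
  have -> : c *: ncpoly_eval S p + ncpoly_eval S q - (c *: X + Y) =
     c *: (ncpoly_eval S p - X) + (ncpoly_eval S q - Y).
    by rewrite opprD addrACA scalerBr.
  apply: le_lt_trans (opnormD _ _) _; rewrite [e]splitr; apply: ler_ltD => //.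
  apply: le_trans (opnormZ_le _ _) _.
  apply: le_trans (_ : (normc c + 1) * opnorm (ncpoly_eval S p - X) <= _).
    by rewrite ler_wpM2r ?opnorm_ge0// lerDl.
  by rewrite mulrC -ler_pdivlMr// ltW.
- have X0 : 0 < opnorm X + 1 by rewrite ltr_wpDl ?opnorm_ge0.
  have Y0 : 0 < opnorm Y + 1 by rewrite ltr_wpDl ?opnorm_ge0.
  (* [e1 <= 1] bounds the approximant of [Y] by [opnorm Y + 1] before that of [X] is used; the other
     condition makes the second error term small. *)
  have [e1 e10 [e11 e1e]] : exists2 e1 : R, 0 < e1 & e1 <= 1 /\ e1 <= e / 2 / (opnorm X + 1).
    exists (Num.min 1 (e / 2 / (opnorm X + 1))).
      by rewrite lt_min ltr01 !divr_gt0.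
    by rewrite !ge_min !lexx orbT.
  have [q qe] := CY e1 e10.
  have [p pe] := CX (e / 2 / (opnorm Y + 1)) (divr_gt0 (divr_gt0 e0 (ltr0Sn _ _)) Y0).
  have [r rP] := ncpoly_mul p q; exists r; rewrite rP.
  move: (ncpoly_eval S p) (ncpoly_eval S q) pe qe => p' q' pe qe.
  have -> : bop_comp p' q' - bop_comp X Y =
     bop_comp (p' - X) q' + bop_comp X (q' - Y).
    apply: bopP => x.
    rewrite -[LHS]/(p' (q' x) - X (Y x)).
    rewrite -[RHS]/((p' (q' x) - X (q' x)) + X (q' x - Y x)).
    by rewrite linearB /= addrA subrK.
  have q'Y : opnorm q' <= opnorm Y + 1.
    have -> : q' = Y + (q' - Y) by rewrite addrC subrK.
    apply: le_trans (opnormD _ _) _; rewrite lerD2l.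
    exact: le_trans (ltW qe) e11.
  apply: le_lt_trans (opnormD _ _) _.
  have := opnorm_comp (p' - X) q'; have := opnorm_comp X (q' - Y).
  have x0 := opnorm_ge0 X; have u0 := opnorm_ge0 (p' - X).
  move: (opnorm (bop_comp _ _)) (opnorm (bop_comp _ _)) => A B BX AY.
  move: (opnorm X) (opnorm Y) (opnorm q') (opnorm (p' - X)) (opnorm (q' - Y))
    X0 Y0 e1e pe qe q'Y x0 u0 BX AY => x y z u v X0 Y0 e1e pe qe q'Y x0 u0 BX AY.
  have uz : u * z < e / 2.
    by apply: le_lt_trans (ler_wpM2l u0 q'Y) _; rewrite -ltr_pdivlMr.
  have xv : (x + 1) * v < e / 2.
    by rewrite mulrC -ltr_pdivlMr//; apply: lt_le_trans qe e1e.
  have v0 : 0 <= v \/ v < 0 by case: (lerP 0 v); [left | right].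
  have : x * v <= e / 2 by case: v0 => v0; nra.
  lra.
- move/cvgrPdist_lt : XY => /(_ (e / 2)) []; first by rewrite divr_gt0.
  move=> N _ /(_ N); rewrite /= leqnn sub0r normrN ger0_norm ?opnorm_ge0//.
  move=> /(_ isT) XN; have [p pe] := CX N (e / 2) (divr_gt0 e0 (ltr0Sn _ _)).
  exists p; apply: le_lt_trans (opnorm_triangle _ (X N) _) _.
  by rewrite (splitr e) ltrD.
Qed.

End NcPoly.

(** * Evaluation of disc algebra elements *)

Section ConstantTerm.
Variables (R : realType) (n : nat).
Local Notation S := (@left_creation R n).
Implicit Types p : ncpoly R n.

Lemma hnorm_vacuum : hnorm (vacuum R n) = 1.
Proof.
rewrite /hnorm -[vacuum R n]/(fock_basis R [::]) basis_orthonormal /=.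
by rewrite sqrtr1.
Qed.

Lemma at_zero_eval p : at_zero (ncpoly_eval S p) = p [::].
Proof.
have [L LP] := ncpoly_eval_words p; rewrite /at_zero (LP L)// bop_sumE inner_suml.
rewrite (bigD1_seq [::]) ?uniq_words_le ?mem_words_le//=.
rewrite big1 => [|w w0]; rewrite innerZl -[vacuum R n]/(fock_basis R [::]).
  by rewrite basis_orthonormal eqxx mulr1 addr0.
by rewrite opword_basis cats0 basis_orthonormal (negPf w0) mulr0.
Qed.

Lemma at_zero_le (f : 'B(fock R n)) : normc (at_zero f) <= opnorm f.
Proof.
apply: le_trans (inner_CauchySchwarz _ _) _.
by rewrite hnorm_vacuum mulr1 -[leRHS]mulr1 -hnorm_vacuum opnormP.
Qed.

Lemma at_zeroB (f g : 'B(fock R n)) : at_zero (f - g) = at_zero f - at_zero g.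
Proof. by rewrite /at_zero -linearBl. Qed.

Definition nonempty_words L : seq (word n) :=
  [seq w <- words_le n L | w != [::]].

Lemma nonempty_words_neq0 L w : w \in nonempty_words L -> w != [::].
Proof. by rewrite mem_filter => /andP[]. Qed.

Definition nonconstant (H : innerType R) (T : 'I_n -> 'B(H)) p : 'B(H) :=
  ncpoly_eval T p - p [::] *: bop_id H.

Lemma nonconstantE p : exists L, forall M, (L <= M)%N ->
  forall (H : innerType R) (T : 'I_n -> 'B(H)) x,
  nonconstant T p x = \sum_(w <- nonempty_words M) p w *: opword T w x.
Proof.
have [L LP] := ncpoly_eval_words p; exists L => M LM H T x.
rewrite -[LHS]/(ncpoly_eval T p x - p [::] *: x) (LP M)// bop_sumE.
rewrite (bigD1_seq [::]) ?uniq_words_le ?mem_words_le//= addrAC.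
rewrite [X in X - _](_ : _ = p [::] *: x)// subrr add0r.
by rewrite big_filter.
Qed.

End ConstantTerm.

Section Evaluation.
Variables (R : realType) (H : hilbertType R) (n : nat) (T : 'I_n -> 'B(H)).
Hypothesis wT : (joint_numerical_radius T <= 1%:E)%E.
Local Notation S := (@left_creation R n).
Implicit Types p : ncpoly R n.

Lemma Re_numerical_radius N (h : word n -> H) : supp_le N h ->
  complex.Re (\sum_(w <- words_le n N) \sum_j inner (h w) (T j (h (j :: w))))
  <= \sum_(w <- words_le n N) hnorm (h w) ^+ 2.
Proof.
move=> hN; apply: le_trans (ler_Re_normc _) _.
exact: joint_numerical_radius_finite.
Qed.

(** The polynomial bound for a single polynomial and a family with [x] at the root and [y] at its
    only child controls one pairing [<p(T) y, x>]. The 2 is the usual loss in passing from a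
    numerical radius to a norm. *)
Lemma nonconstant_bound p c : 0 < c -> opnorm (nonconstant S p) <= c ->
  opnorm (nonconstant T p) <= 2 * c.
Proof.
move=> c0 pc; have [L LP] := nonconstantE p.
pose A := nonempty_words n L.
pose g (u : unit) (q : 'I_1 * unit) w := p w.
have one (V : nmodType) (F : 'I_1 * unit -> V) : \sum_q F q = F (ord0, tt).
  rewrite (big_pred1 (ord0, tt)) // => -[i u]; apply/esym/eqP.
  by case: u; rewrite (ord1 i).
have oneu (V : nmodType) (F : unit -> V) : \sum_u F u = F tt.
  by rewrite (big_pred1 tt) // => u; apply/esym/eqP; case: u.
have gb : fock_bound A g (c ^+ 2).
  move=> e N; rewrite oneu !one -(LP L)// -hnorm_comb ?uniq_words_le// -exprMn.
  rewrite ler_sqr ?nnegrE ?hnorm_ge0// ?mulr_ge0 ?hnorm_ge0 ?(ltW c0)//.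
  by apply: le_trans (opnormP _ _) _; rewrite ler_wpM2r ?hnorm_ge0.
have main x y : normc (inner (nonconstant T p y) x) <=
    c * (hnorm x ^+ 2 + hnorm y ^+ 2).
  pose h (w : word 1) (_ : unit) := match w with
    | [::] => x | [:: _] => y | _ => 0 end.
  have hN w : (1 < size w)%N -> forall u, h w u = 0 by case: w => [|? []].
  have -> : inner (nonconstant T p y) x =
      \sum_(v <- A) p v * inner (opword T v y) x.
    by rewrite (LP L)// inner_suml; apply: eq_bigr => v _; rewrite innerZl.
  have := polynomial_bound Re_numerical_radius c0
    (@nonempty_words_neq0 n L) gb hN.
  rewrite !(big_words_leS, big_words_le0, big_words_consE, big_seq1, big_ord1).
  rewrite !oneu !one /= [X in _ + X]big1 => [|v _]; last by rewrite linear0 linear0l mulr0.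
  rewrite addr0 => /le_trans; apply.
  by rewrite le_eqVlt; apply/orP; left; apply/eqP.
apply: opnorm_le => [|y]; first by rewrite mulr_ge0 ?(ltW c0).
set z := nonconstant T p y.
have [z0|z0] := eqVneq (hnorm z) 0.
  by rewrite z0 !mulr_ge0 ?hnorm_ge0 ?(ltW c0).
have zp : 0 < hnorm z by rewrite lt_neqAle eq_sym z0 hnorm_ge0.
have [hy|y0] := eqVneq (hnorm y) 0.
  by move: z0; rewrite /z (hnorm_eq0 hy) linear0 hnorm0 eqxx.
(* The first vector is the multiple of [z] with the norm of [y], which makes the two squares on the
   right equal. *)
have := main ((hnorm y / hnorm z)%:C%C *: z) y.
rewrite innerZr conj_realC normcM normc_real innerE normc_real.
rewrite !ger0_norm ?sqr_ge0 ?divr_ge0 ?hnorm_ge0//.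
rewrite hnormZ normc_real ger0_norm ?divr_ge0 ?hnorm_ge0// divfK//.
have -> : hnorm y / hnorm z * hnorm z ^+ 2 = hnorm y * hnorm z by field.
have yp : 0 < hnorm y by rewrite lt_neqAle eq_sym y0 hnorm_ge0.
move=> hm; rewrite -(ler_pM2l yp); apply: le_trans hm _.
rewrite le_eqVlt; apply/orP; left; apply/eqP; ring.
Qed.

Lemma opnorm_id_le (K : innerType R) : opnorm (bop_id K) <= 1.
Proof. by apply: opnorm_le => // x; rewrite mul1r. Qed.

(** With [M] the norm of [p(S)]: the constant term costs [M], so the rest has norm at most [2 M] at
    [S] and [4 M] at [T], in total [5 M]. The auxiliary [e] provides the strictly positive constant
    that [nonconstant_bound] requires. *)
Lemma ncpoly_eval_bound p :
  opnorm (ncpoly_eval T p) <= 5 * opnorm (ncpoly_eval S p).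
Proof.
have arith (u v M' e' : R) : u <= M' -> v <= 2 * (2 * M' + e') ->
  v + u <= 5 * M' + 2 * e' by lra.
set N := opnorm _; set M := opnorm _.
have M0 : 0 <= M by exact: opnorm_ge0.
have p0 : normc (p [::]) <= M by rewrite -at_zero_eval; exact: at_zero_le.
have c0 (K : innerType R) : opnorm (p [::] *: bop_id K) <= M.
  apply: le_trans (opnormZ_le _ _) _; rewrite -[leRHS]mulr1.
  by rewrite ler_pM ?normc_ge0 ?opnorm_ge0 ?opnorm_id_le.
have nS : opnorm (nonconstant S p) <= 2 * M.
  apply: le_trans (opnormD _ _) _; rewrite mulr_natl mulr2n lerD2l.
  by have := c0 (fock R n); rewrite -[- _]add0r -[in X in X -> _](subr0 (_ *: _)) opnorm_distC.
apply: (@ler_mul_eps _ _ _ 2) => // e e0.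
have := @nonconstant_bound p (2 * M + e).
have -> : N = opnorm (nonconstant T p + p [::] *: bop_id H) by rewrite subrK.
have e1 : 0 < 2 * M + e by rewrite ltr_wpDl ?mulr_ge0.
move=> /(_ e1) h; apply: le_trans (opnormD _ _) _.
have := h (le_trans nS (_ : _ <= 2 * M + e)); rewrite lerDl (ltW e0) => /(_ isT).
have := c0 H.
exact: arith.
Qed.

Lemma bop_complete (X : nat -> 'B(H)) :
  (forall e, 0 < e -> exists N, forall i j, (N <= i)%N -> (N <= j)%N ->
    opnorm (X i - X j) <= e) ->
  exists Y, bop_cvg X Y.
Proof.
move=> cauchy.
have bE i j x : (X i - X j) x = X i x - X j x by [].
have ex x : exists l, hnorm (X i x - l) @[i --> \oo] --> (0 : R).
  apply: hilbert_complete => e e0.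
  have x0 : 0 < hnorm x + 1 by rewrite ltr_wpDl ?hnorm_ge0.
  have [N NP] := cauchy (e / (hnorm x + 1)) (divr_gt0 e0 x0).
  exists N => i j Ni Nj; rewrite -bE.
  apply: le_lt_trans (opnormP _ _) _.
  apply: le_lt_trans (_ : _ <= e / (hnorm x + 1) * hnorm x) _.
    by rewrite ler_wpM2r ?hnorm_ge0// NP.
  by rewrite mulrAC ltr_pdivrMr// ltr_pM2l// ltrDl.
pose Y x := projT1 (cid (ex x)).
have YP x : hnorm (X i x - Y x) @[i --> \oo] --> (0 : R) := projT2 (cid (ex x)).
have lim0 (u : nat -> R) (r : R) : u i @[i --> \oo] --> (0 : R) ->
    (forall i, r <= u i) -> r <= 0.
  by move=> u0 ru; apply: cvgr_to_ge u0 _; apply: nearW.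
have Yl : linear Y.
  move=> c x y; apply/eqP; rewrite -subr_eq0; apply/eqP/hnorm_eq0/eqP.
  rewrite eq_le hnorm_ge0 andbT.
  apply: (lim0 (fun i => hnorm (X i (c *: x + y) - Y (c *: x + y)) +
    (normc c * hnorm (X i x - Y x) + hnorm (X i y - Y y)))).
    rewrite -[0]addr0; apply: cvgD; first exact: YP.
    rewrite -[0]addr0; apply: cvgD; last exact: YP.
    by rewrite -(mulr0 (normc c)); apply: cvgMr; exact: YP.
  move=> i; rewrite -hnormZ [hnorm (X i (c *: x + y) - _)]hnorm_distC.
  apply: le_trans (lerD (lexx _) (ler_hnormD _ _)).
  apply: le_trans (ler_hnormD _ _).
  rewrite le_eqVlt; apply/orP; left; apply/eqP; congr hnorm.
  by rewrite (linearP (X i)) scalerBr [X in _ = _ + X]addrACA -opprD addrA subrK.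
have near_Y e N x : (forall i j, (N <= i)%N -> (N <= j)%N ->
    opnorm (X i - X j) <= e) -> forall i, (N <= i)%N ->
    hnorm (X i x - Y x) <= e * hnorm x.
  move=> NP i Ni; rewrite -subr_le0.
  have cv : (hnorm (X (j + N)%N x - Y x)) @[j --> \oo] --> (0 : R).
    by rewrite (cvg_shiftn N (fun j => hnorm (X j x - Y x))).
  apply: lim0 cv _ => j; rewrite lerBlDr.
  have -> : X i x - Y x = (X (j + N)%N x - Y x) + (X i x - X (j + N)%N x).
    by rewrite [RHS]addrC addrA subrK.
  apply: le_trans (ler_hnormD _ _) _; rewrite lerD2l -bE.
  apply: le_trans (opnormP _ _) _; rewrite ler_wpM2r ?hnorm_ge0//.
  by apply: NP => //; exact: leq_addl.
have Yb : Y \in @bounded_linear R H H.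
  apply/bounded_linearP; split=> //.
  have [N NP] := cauchy 1 ltr01; exists (opnorm (X N) + 1) => x.
  have -> : Y x = X N x - (X N x - Y x) by rewrite opprB addrC subrK.
  apply: le_trans (ler_hnormD _ _) _; rewrite hnormN mulrDl.
  by apply: lerD; [exact: opnormP | exact: near_Y NP _ _].
exists (Bop Yb); apply/cvgrPdist_le => e e0; have [N NP] := cauchy e e0.
exists N => //= i Ni; rewrite sub0r normrN ger0_norm ?opnorm_ge0//.
by apply: opnorm_le => [|x]; [exact: ltW | exact: near_Y NP _ Ni].
Qed.

Lemma ncpoly_evalB p q : opnorm (ncpoly_eval T p - ncpoly_eval T q) <=
  5 * opnorm (ncpoly_eval S p - ncpoly_eval S q).
Proof.
have [r rP] := ncpoly_lin (- 1) q p.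
by have := ncpoly_eval_bound r; rewrite !rP !scaleN1r ![- _ + _]addrC.
Qed.

(** [nc_eval] falls back to 0 when its defining set is empty. Boundedness of evaluation and
    completeness show that it is not, after which its value is the limit along one explicit
    sequence. *)
Lemma nc_eval_approx f : nc_disc_algebra f -> forall e, 0 < e ->
  exists p, opnorm (ncpoly_eval S p - f) < e /\
            opnorm (ncpoly_eval T p - nc_eval T f) < e.
Proof.
have cvg0_comb (u v w : nat -> R) : u j @[j --> \oo] --> (0 : R) ->
    v j @[j --> \oo] --> (0 : R) -> w j @[j --> \oo] --> (0 : R) ->
    5 * (u j + v j) + w j @[j --> \oo] --> (0 : R).
  move=> u0 v0 w0; have -> : (0 : R) = 5 * (0 + 0) + 0 by rewrite !addr0 mulr0.
  by apply: cvgD w0; apply: cvgMr; exact: cvgD.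
have arith (r ri rj u v d e : R) : r < e / 10 -> rj <= r -> ri <= r ->
  v < rj -> u < ri -> d <= u + v -> 5 * d <= e by lra.
move=> /disc_algebra_approx fA.
have l0 l : 0 < l.+1%:R^-1 :> R by rewrite invr_gt0.
pose P l := projT1 (cid (fA _ (l0 l))).
have PP l : opnorm (ncpoly_eval S (P l) - f) < l.+1%:R^-1 := projT2 (cid (fA _ (l0 l))).
have le l N : (N <= l)%N -> l.+1%:R^-1 <= N.+1%:R^-1 :> R.
  by move=> ?; rewrite lef_pV2 ?posrE// ler_nat.
have Pf : bop_cvg (fun l => ncpoly_eval S (P l)) f.
  apply/cvgrPdist_le => e /exists_invS_lt[N NP]; exists N => //= l Nl.
  rewrite sub0r normrN ger0_norm ?opnorm_ge0// (le_trans (ltW (PP l)))//.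
  exact: le_trans (le _ _ Nl) (ltW NP).
have [Y PY] : exists Y, bop_cvg (fun l => ncpoly_eval T (P l)) Y.
  apply: bop_complete => e e0.
  (* Two errors below [e / 10], multiplied by the constant 5 of [ncpoly_evalB]. *)
  have [N NP] := @exists_invS_lt R (e / 10) (divr_gt0 e0 (ltr0Sn _ _)).
  exists N => i j Ni Nj; apply: le_trans (ncpoly_evalB _ _) _.
  have := opnorm_triangle (ncpoly_eval S (P i)) f (ncpoly_eval S (P j)).
  rewrite [opnorm (f - _)]opnorm_distC.
  exact: arith NP (le _ _ Nj) (le _ _ Ni) (PP j) (PP i).
(* The limit along [P] serves every approximating sequence, since two such sequences differ at [T]
   by at most 5 times their difference at [S]. *)
have Yset : [set Y | forall p : nat -> ncpoly R n,
    bop_cvg (fun j => ncpoly_eval S (p j)) f ->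
    bop_cvg (fun j => ncpoly_eval T (p j)) Y] Y.
  move=> p pf.
  apply: (@squeeze_cvgr _ _ _ _ (fun=> 0) (fun j =>
    5 * (opnorm (ncpoly_eval S (p j) - f) + opnorm (ncpoly_eval S (P j) - f))
     + opnorm (ncpoly_eval T (P j) - Y))).
  - apply: nearW => j; rewrite opnorm_ge0 /=.
    apply: le_trans (opnorm_triangle _ (ncpoly_eval T (P j)) _) _.
    rewrite lerD2r; apply: le_trans (ncpoly_evalB _ _) _; rewrite ler_wpM2l//.
    by rewrite [X in _ <= _ + X]opnorm_distC opnorm_triangle.
  - exact: cvg_cst.
  - exact: (cvg0_comb _ _ _ pf Pf PY).
have evalP := @xgetI _ 0 _ _ Yset.
have {}evalP : bop_cvg (fun l => ncpoly_eval T (P l)) (nc_eval T f).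
  exact: evalP.
move=> e e0; move/cvgrPdist_lt : evalP => /(_ e e0)[N _ NP].
have [M MP] := exists_invS_lt e0; pose l := maxn N M.
exists (P l); split.
  apply: lt_le_trans (PP l) _; apply: le_trans (le _ M _) (ltW MP).
  exact: leq_maxr.
have := NP l (leq_maxl _ _); rewrite /= sub0r normrN ger0_norm ?opnorm_ge0//.
Qed.

End Evaluation.

(** * Scalar matrices *)

Section ScalarMatrices.
Variable R : realType.

Lemma real_CauchySchwarz (I : finType) (u v : I -> R) :
  \sum_i u i * v i <= Num.sqrt (\sum_i u i ^+ 2) * Num.sqrt (\sum_i v i ^+ 2).
Proof.
set s := \sum_i u i * v i; set U := \sum_i u i ^+ 2; set V := \sum_i v i ^+ 2.
have U0 : 0 <= U by apply: sumr_ge0 => i _; exact: sqr_ge0.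
have V0 : 0 <= V by apply: sumr_ge0 => i _; exact: sqr_ge0.
rewrite -sqrtrM// (le_trans (ler_norm _))// -sqrtr_sqr ler_wsqrtr//.
have gen a b : \sum_i (a * u i - b * v i) ^+ 2 = a ^+ 2 * U - 2 * a * b * s + b ^+ 2 * V.
  rewrite /U /V /s !mulr_sumr -sumrB -big_split /=; apply: eq_bigr => i _; ring.
have key : 0 <= V * (V * U - s ^+ 2).
  have -> : V * (V * U - s ^+ 2) = \sum_i (V * u i - s * v i) ^+ 2.
    by rewrite gen; ring.
  by apply: sumr_ge0 => i _; exact: sqr_ge0.
have [V1|V1] := eqVneq V 0; last first.
  have Vp : 0 < V by rewrite lt_neqAle eq_sym V1.
  by move: key; rewrite pmulr_rge0// subr_ge0 mulrC.
have v0 i : v i = 0.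
  apply/eqP; rewrite -sqrf_eq0 eq_le sqr_ge0 andbT -V1 /V (bigD1 i)//= lerDl.
  by apply: sumr_ge0 => j _; exact: sqr_ge0.
have -> : s = 0 by rewrite /s big1// => i _; rewrite v0 mulr0.
by rewrite V1 mulr0 expr0n.
Qed.

Lemma hnorm_scalar (z : R[i]^o) : hnorm z = normc z.
Proof.
apply: (@pexpIrn _ 2) => //; rewrite ?nnegrE ?hnorm_ge0 ?normc_ge0//.
rewrite -qf_inner /qf -[pform _ z z]/(z * Num.conj (z : R[i])) mulc_conj//.
Qed.

Definition scalar_op (L : innerType R) m (A : 'M[R[i]]_m) :
  'B({ffun 'I_m -> L}) := mxop (map_mx (fun c => c *: bop_id L) A).

Lemma scalar_opE (L : innerType R) m (A : 'M[R[i]]_m) (x : {ffun 'I_m -> L}) a :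
  scalar_op L A x a = \sum_b A a b *: x b.
Proof. by rewrite ffunE; apply: eq_bigr => b _; rewrite mxE. Qed.

(** The norm of [A] tensored with the identity does not exceed that of [A]: in Gram-Schmidt
    coordinates of the entries of [x], [A] acts on each coordinate vector separately as on Euclidean
    space. *)
Lemma scalar_op_bound (L : innerType R) m (A : 'M[R[i]]_m)
    (x : {ffun 'I_m -> L}) : hnorm (scalar_op L A x) <= mxnorm A * hnorm x.
Proof.
have mu0 : 0 <= mxnorm A by exact: opnorm_ge0.
rewrite -ler_sqr ?nnegrE ?mulr_ge0 ?hnorm_ge0// exprMn !hnorm_dsum.
have [phis [lin E _]] := gram_schmidt (inner_form L) [seq x b | b <- enum 'I_m].
have inx b : x b \in [seq x b | b <- enum 'I_m].
  by apply/mapP; exists b; rewrite ?mem_enum.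
have phi_sum phi (c : 'I_m -> R[i]) : phi \in phis ->
    phi (\sum_b c b *: x b) = \sum_b c b * phi (x b).
  move=> /lin l; elim/big_rec2: _ => [|b y z _ <-]; last exact: l.
  have := l 1 0 0; rewrite scaler0 addr0 mul1r => /eqP.
  by rewrite -subr_eq0 opprD addrA subrr sub0r oppr_eq0 => /eqP.
have normE (c : 'I_m -> R[i]) : hnorm (\sum_b c b *: x b) ^+ 2 =
    \sum_(phi <- phis) normc (\sum_b c b * phi (x b)) ^+ 2.
  rewrite -qf_inner /qf [X in complex.Re X]pf_suml.
  under eq_bigr do rewrite pfZl E ?inx// mulr_sumr.
  rewrite exchange_big raddf_sum big_seq [RHS]big_seq; apply: eq_bigr => phi phiin /=.
  under eq_bigr do rewrite mulrA.
  by rewrite -mulr_suml phi_sum// mulc_conj.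
have -> : \sum_a hnorm (scalar_op L A x a) ^+ 2 =
    \sum_(phi <- phis) \sum_a normc (\sum_b A a b * phi (x b)) ^+ 2.
  by rewrite exchange_big; apply: eq_bigr => a _; rewrite scalar_opE normE.
have -> : \sum_b hnorm (x b) ^+ 2 =
    \sum_(phi <- phis) \sum_b normc (phi (x b)) ^+ 2.
  rewrite exchange_big; apply: eq_bigr => b _.
  rewrite -qf_inner /qf E// raddf_sum; apply: eq_bigr => phi _.
  by rewrite /= mulc_conj.
rewrite mulr_sumr; apply: ler_sum => phi _.
pose y : {ffun 'I_m -> R[i]^o} := [ffun b => phi (x b)].
have : hnorm (scalar_op R[i]^o A y) ^+ 2 <= (mxnorm A * hnorm y) ^+ 2.
  by rewrite ler_sqr ?nnegrE ?mulr_ge0 ?hnorm_ge0//; exact: opnormP.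
rewrite exprMn !hnorm_dsum.
under eq_bigr do rewrite scalar_opE hnorm_scalar.
under [X in _ * X]eq_bigr do rewrite hnorm_scalar ffunE.
under eq_bigr do under eq_bigr do rewrite ffunE.
exact.
Qed.

Lemma scalar_row_bound (L : innerType R) k m (A : 'I_k -> 'M[R[i]]_m)
    (x : {ffun 'I_k -> {ffun 'I_m -> L}}) :
  hnorm (\sum_j scalar_op L (A j) (x j)) <=
  Num.sqrt (\sum_j mxnorm (A j) ^+ 2) * hnorm x.
Proof.
apply: le_trans (ler_hnorm_sum _ _) _.
apply: le_trans (_ : \sum_j mxnorm (A j) * hnorm (x j) <= _).
  by apply: ler_sum => j _; exact: scalar_op_bound.
apply: le_trans (real_CauchySchwarz _ _) _.
by rewrite -hnorm_dsum sqrtr_sqr (ger0_norm (hnorm_ge0 _)).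
Qed.

Lemma tree_sum_le d N (B : word d -> R) : (forall w, 0 <= B w) ->
  (forall w, (N < size w)%N -> B w = 0) ->
  \sum_(w <- words_le d N) \sum_j B (j :: w) <= \sum_(w <- words_le d N) B w.
Proof.
move=> B0 BN; have := big_words_le_consE N B.
rewrite (big_words_le_supp BN (leqnSn N)) exchange_big => -> /=.
by rewrite lerDr.
Qed.

End ScalarMatrices.

(** * The main estimate *)

Section Approximation.
Variables (R : realType) (H : hilbertType R) (n m k : nat).
Variables (T : 'I_n -> 'B(H)) (F : 'I_k -> 'M['B(fock R n)]_m).
Local Notation S := (@left_creation R n).
Local Notation Z j := (map_mx (@at_zero R n) (F j)).
Local Notation Q := ('I_k * 'I_m)%type.

Let c0 := opnorm (rowop (fun j => mxop (F j))).
Let rho := Num.sqrt (\sum_j mxnorm (Z j) ^+ 2).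
(** [K] counts the entries of all the matrices together, [K'] those of a single one; both only
    multiply the error [e]. *)
Let K : R := \sum_(a < m) \sum_(q : Q) 1.
Let K' : R := \sum_(a < m) \sum_(b < m) 1.

Variable e : R.
Hypothesis e_gt0 : 0 < e.
Variable p : 'I_k -> 'I_m -> 'I_m -> ncpoly R n.
Hypotheses
  (pS : forall j a b, opnorm (ncpoly_eval S (p j a b) - F j a b) < e)
  (pT : forall j a b, opnorm (ncpoly_eval T (p j a b) - nc_eval T (F j a b)) < e).

Lemma K_ge0 : 0 <= K.
Proof. by apply: sumr_ge0 => a _; apply: sumr_ge0. Qed.

Lemma K'_ge0 : 0 <= K'.
Proof. by apply: sumr_ge0 => a _; apply: sumr_ge0. Qed.

Lemma constant_term_approx j a b : normc (p j a b [::] - Z j a b) <= e.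
Proof.
rewrite mxE -at_zero_eval -at_zeroB; exact: le_trans (at_zero_le _) (ltW (pS _ _ _)).
Qed.

(** One [e] comes from the approximation of [G], the other from that of the constant term. Stated
    for arbitrary [V] because it is used at [S] and at [T]. *)
Lemma remainder_bound (L : innerType R) (V : 'I_n -> 'B(L)) (G : 'B(L)) j a b x :
  opnorm (ncpoly_eval V (p j a b) - G) < e ->
  hnorm (nonconstant V (p j a b) x - (G x - Z j a b *: x)) <= 2 * e * hnorm x.
Proof.
move=> VG.
have -> : nonconstant V (p j a b) x - (G x - Z j a b *: x) =
    (ncpoly_eval V (p j a b) - G) x - (p j a b [::] - Z j a b) *: x.
  rewrite -[nonconstant _ _ _]/(ncpoly_eval V (p j a b) x - p j a b [::] *: x).
  rewrite -[(_ - G) x]/(ncpoly_eval V (p j a b) x - G x).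
  by rewrite scalerBl !opprB addrACA [in RHS]addrACA [- _ + _]addrC.
apply: le_trans (ler_hnormD _ _) _; rewrite hnormN hnormZ.
have h1 := opnormP (ncpoly_eval V (p j a b) - G) x.
have h2 := ler_wpM2r (hnorm_ge0 x) (ltW VG).
have h3 := ler_wpM2r (hnorm_ge0 x) (constant_term_approx j a b).
apply: le_trans (lerD (le_trans h1 h2) h3) _.
by rewrite -mulrDl mulr_natl.
Qed.

(** [2 K e] collects an error [2 e] per entry; the additional [e] keeps [c] positive even when [c0]
    and [rho] vanish. *)
Let c := c0 + rho + (2 * K + 1) * e.

Lemma c_gt0 : 0 < c.
Proof.
have r0 : 0 <= rho by exact: sqrtr_ge0.
have k0 : 0 < (2 * K + 1) * e by rewrite mulr_gt0// ltr_wpDl// mulr_ge0// K_ge0.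
by apply: ltr_wpDl k0; rewrite addr_ge0// opnorm_ge0.
Qed.

Lemma exists_length : exists M, forall (L : innerType R) (V : 'I_n -> 'B(L)) j a b x,
  nonconstant V (p j a b) x =
  \sum_(w <- nonempty_words n M) p j a b w *: opword V w x.
Proof.
pose l (z : 'I_k * ('I_m * 'I_m)) := projT1 (cid (nonconstantE (p z.1 z.2.1 z.2.2))).
have lP z := projT2 (cid (nonconstantE (p z.1 z.2.1 z.2.2))).
exists (\max_z l z)%N => L V j a b x.
by apply: (lP (j, (a, b))); exact: (leq_bigmax (j, (a, b))).
Qed.

Let g (a : 'I_m) (q : Q) w : R[i] := p q.1 a q.2 w.

(** On Fock space the row of nonconstant parts is [[F_j]] minus the scalar row [[F_j(0)]] plus an
    error, of norms at most [c0], [rho] and [2 K e]. This is the first payment of [rho]. *)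
Lemma row_fock_bound M :
  (forall (L : innerType R) (V : 'I_n -> 'B(L)) j a b x,
    nonconstant V (p j a b) x =
    \sum_(w <- nonempty_words n M) p j a b w *: opword V w x) ->
  fock_bound (nonempty_words n M) g (c ^+ 2).
Proof.
move=> MP d N.
pose xi (q : Q) := fock_comb (words_le n N) (d q).
pose Xi : {ffun 'I_k -> {ffun 'I_m -> fock R n}} := [ffun j => [ffun b => xi (j, b)]].
have hXi : \sum_q \sum_(w <- words_le n N) normc (d q w) ^+ 2 = hnorm Xi ^+ 2.
  rewrite hnorm_dsum.
  transitivity (\sum_j \sum_b hnorm (xi (j, b)) ^+ 2); last first.
    by apply: eq_bigr => j _; rewrite hnorm_dsum ffunE; apply: eq_bigr => b _; rewrite ffunE.
  rewrite pair_bigA /=; apply: eq_bigr => -[j b] _.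
  by rewrite hnorm_comb// uniq_words_le.
have xiE q : xi q = Xi q.1 q.2 by rewrite !ffunE; case: q.
have xi_le q : hnorm (xi q) <= hnorm Xi.
  by rewrite xiE; apply: le_trans (hnorm_dsum_comp _ _) (hnorm_dsum_comp _ _).
pose E (a : 'I_m) (q : Q) := nonconstant S (p q.1 a q.2) (xi q) -
  (F q.1 a q.2 (xi q) - Z q.1 a q.2 *: xi q).
pose zeta : {ffun 'I_m -> fock R n} :=
  [ffun a => \sum_q nonconstant S (p q.1 a q.2) (xi q)].
pose err : {ffun 'I_m -> fock R n} := [ffun a => \sum_q E a q].
have zetaE : zeta = rowop (fun j => mxop (F j)) Xi
    - \sum_j scalar_op (fock R n) (Z j) (Xi j) + err.
  apply/ffunP => a; rewrite !ffunE /= !sum_ffunE -sumrN -big_split /=.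
  transitivity (\sum_j \sum_b (F j a b (Xi j b) - Z j a b *: Xi j b) + \sum_q E a q).
    rewrite pair_bigA -big_split /=; apply: eq_bigr => q _.
    by rewrite /E -xiE addrC subrK.
  congr (_ + _); apply: eq_bigr => j _.
  by rewrite scalar_opE sumrB; congr (_ - _); rewrite [RHS]ffunE.
rewrite [X in X <= _](_ : _ = hnorm zeta ^+ 2); last first.
  rewrite hnorm_dsum; apply: eq_bigr => a _; rewrite ffunE.
  by congr (hnorm _ ^+ 2); apply: eq_bigr => q _; rewrite MP.
rewrite hXi -exprMn ler_sqr ?nnegrE ?mulr_ge0 ?hnorm_ge0 ?(ltW c_gt0)//.
rewrite zetaE /c !mulrDl.
apply: le_trans (ler_hnormD _ _) _; apply: lerD.
  apply: le_trans (ler_hnormD _ _) _; rewrite hnormN; apply: lerD.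
    exact: opnormP.
  exact: scalar_row_bound.
apply: le_trans (hnorm_dsum_le _) _.
apply: le_trans (_ : \sum_(a < m) \sum_(q : Q) 1 * (2 * e * hnorm Xi) <= _).
  apply: ler_sum => a _; rewrite ffunE.
  apply: le_trans (ler_hnorm_sum _ _) _; apply: ler_sum => q _.
  apply: le_trans (remainder_bound _ (pS _ _ _)) _.
  by rewrite mul1r ler_wpM2l// mulr_ge0// ltW.
have -> : \sum_(a < m) \sum_(q : Q) 1 * (2 * e * hnorm Xi) = K * (2 * e * hnorm Xi).
  by rewrite /K mulr_suml; apply: eq_bigr => a _; rewrite mulr_suml.
rewrite -subr_ge0 [X in 0 <= X](_ : _ = e * hnorm Xi); last by ring.
by rewrite mulr_ge0 ?hnorm_ge0// ltW.
Qed.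

Hypothesis wT : (joint_numerical_radius T <= 1%:E)%E.

(** Adding the constant terms back at [T] costs the second [rho]; the approximation at [T] costs
    [(K + K') e]. *)
Lemma finite_family_bound N (h : word k -> {ffun 'I_m -> H}) : supp_le N h ->
  normc (\sum_(w <- words_le k N) \sum_j
    inner (h w) (mxop (map_mx (nc_eval T) (F j)) (h (j :: w))))
  <= (c + rho + (K + K') * e) * \sum_(w <- words_le k N) hnorm (h w) ^+ 2.
Proof.
move=> hN; have [M MP] := exists_length.
set s := \sum_(w <- _) hnorm _ ^+ 2.
have hN' w : (N < size w)%N -> forall a, h w a = 0 by move=> /hN -> a; rewrite ffunE.
have main := polynomial_bound (Re_numerical_radius wT) c_gt0
  (@nonempty_words_neq0 n M) (row_fock_bound MP) hN'.
have tree : \sum_(w <- words_le k N) \sum_j hnorm (h (j :: w)) ^+ 2 <= s.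
  apply: (tree_sum_le (B := fun w => hnorm (h w) ^+ 2)) => w.
    exact: sqr_ge0.
  by move=> /hN ->; rewrite hnorm0 expr0n.
pose D w := \sum_a \sum_(q : Q)
  inner (nonconstant T (p q.1 a q.2) (h (q.1 :: w) q.2)) (h w a).
pose C w := inner (h w) (\sum_j scalar_op H (Z j) (h (j :: w))).
pose E w (a : 'I_m) (q : Q) := nonconstant T (p q.1 a q.2) (h (q.1 :: w) q.2) -
  (nc_eval T (F q.1 a q.2) (h (q.1 :: w) q.2) - Z q.1 a q.2 *: h (q.1 :: w) q.2).
pose B w := \sum_a \sum_(q : Q) inner (h w a) (E w a q).
(* [polynomial_bound] has the operator in the first slot of the inner product and the numerical
   radius has it in the second, hence the conjugate on [D]. [C] carries the constant terms, [B] the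
   approximation error. *)
have split_w w : \sum_j inner (h w) (mxop (map_mx (nc_eval T) (F j)) (h (j :: w)))
    = (D w)^* + C w - B w.
  rewrite /C inner_sumr.
  have innE (x y : {ffun 'I_m -> H}) : inner x y = \sum_a inner (x a) (y a) by [].
  under eq_bigr do rewrite innE.
  under [X in _ = _ + X - _]eq_bigr do rewrite innE.
  rewrite exchange_big [X in _ = _ + X - _]exchange_big /=.
  rewrite /D /B rmorph_sum -big_split -sumrB /=; apply: eq_bigr => a _.
  rewrite rmorph_sum /=.
  transitivity (\sum_j \sum_b inner (h w a) (nc_eval T (F j a b) (h (j :: w) b))).
    apply: eq_bigr => j _; rewrite ffunE inner_sumr; apply: eq_bigr => b _.
    by rewrite mxE.
  transitivity (\sum_(q : Q) (inner (nonconstant T (p q.1 a q.2) (h (q.1 :: w) q.2)) (h w a))^*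
    + \sum_j \sum_b inner (h w a) (Z j a b *: h (j :: w) b)
    - \sum_(q : Q) inner (h w a) (E w a q)); last first.
    congr (_ + _ - _); apply: eq_bigr => j _.
    by rewrite scalar_opE inner_sumr.
  rewrite !pair_bigA -big_split -sumrB /=; apply: eq_bigr => q _.
  rewrite -inner_herm /E; set u := h (q.1 :: w) q.2; set v := h w a.
  have iD x y z : inner z (x + y) = inner z x + inner z y := pfDr (inner_form H) x y z.
  have iN x z : inner z (- x) = - inner z x := pfNr (inner_form H) x z.
  rewrite !(iD, iN); ring.
under eq_bigr do rewrite split_w.
rewrite sumrB big_split /=.
apply: le_trans (le_normcD _ _) _; rewrite normcN !mulrDl; apply: lerD.
  apply: le_trans (le_normcD _ _) _; apply: lerD.
    rewrite -rmorph_sum normc_conj.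
    rewrite -!mulrDl -/c.
    have -> : \sum_(w <- words_le k N) D w = \sum_(w <- words_le k N) \sum_a \sum_q
       \sum_(v <- nonempty_words n M) g a q v * inner (opword T v (h (q.1 :: w) q.2)) (h w a).
      apply: eq_bigr => w _; apply: eq_bigr => a _; apply: eq_bigr => q _.
      by rewrite MP inner_suml; apply: eq_bigr => v _; rewrite innerZl.
    apply: le_trans main _; rewrite ler_wpM2l ?(ltW c_gt0)//.
    by apply: ler_sum => w _; rewrite hnorm_dsum.
  have r0 : 0 <= rho by exact: sqrtr_ge0.
  apply: le_trans (ler_normc_sum _ _) _.
  (* Cauchy-Schwarz for the scalar row, then [u v <= (u^2 + v^2) / 2]. Summed over the tree, both
     squares contribute at most [s], so the total is exactly [rho s] with no factor lost. *)
  apply: le_trans (_ : \sum_(w <- words_le k N)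
     rho * ((hnorm (h w) ^+ 2 + \sum_j hnorm (h (j :: w)) ^+ 2) / 2) <= _).
    apply: ler_sum => w _; apply: le_trans (inner_CauchySchwarz _ _) _.
    pose x : {ffun 'I_k -> {ffun 'I_m -> H}} := [ffun j => h (j :: w)].
    have hx : hnorm x ^+ 2 = \sum_j hnorm (h (j :: w)) ^+ 2.
      by rewrite hnorm_dsum; apply: eq_bigr => j _; rewrite ffunE.
    have := scalar_row_bound (fun j => Z j) x.
    under eq_bigr do rewrite ffunE; move=> hs.
    apply: le_trans (ler_wpM2l (hnorm_ge0 _) hs) _.
    rewrite mulrCA -/rho ler_wpM2l// -hx.
    have := sqr_ge0 (hnorm (h w) - hnorm x); rewrite sqrrB; lra.
  rewrite -mulr_sumr -mulr_suml big_split /= ler_wpM2l//.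
  rewrite -/s; lra.
apply: le_trans (ler_normc_sum _ _) _.
apply: le_trans (_ : \sum_(w <- words_le k N) \sum_(a < m) \sum_(q : Q)
  e * (hnorm (h w) ^+ 2 + hnorm (h (q.1 :: w)) ^+ 2) <= _).
  apply: ler_sum => w _.
  apply: le_trans (ler_normc_sum _ _) _; apply: ler_sum => a _.
  apply: le_trans (ler_normc_sum _ _) _; apply: ler_sum => q _.
  apply: le_trans (inner_CauchySchwarz _ _) _.
  have h1 := remainder_bound (h (q.1 :: w) q.2) (pT q.1 a q.2).
  have h2 := hnorm_dsum_comp (h (q.1 :: w)) q.2.
  have h3 := hnorm_dsum_comp (h w) a.
  have e2 : 0 <= 2 * e by rewrite mulr_ge0// ltW.
  have h4 : hnorm (E w a q) <= 2 * e * hnorm (h (q.1 :: w)).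
    by apply: le_trans h1 _; rewrite ler_wpM2l.
  apply: le_trans (ler_pM (hnorm_ge0 _) (hnorm_ge0 _) h3 h4) _.
  rewrite mulrCA [2 * e]mulrC -mulrA ler_wpM2l ?(ltW e_gt0)//.
  have := sqr_ge0 (hnorm (h w) - hnorm (h (q.1 :: w))); rewrite sqrrB; lra.
(* [A] is repeated for every entry, giving [K]. Since [f] depends on [j] alone, only the matrix
   positions [(a, b)] are counted for it, giving [K']. *)
have sumE A (f : 'I_k -> R) : \sum_(a < m) \sum_(q : Q) e * (A + f q.1) =
    K * (e * A) + K' * (e * \sum_j f j).
  rewrite /K /K' !mulr_suml -big_split /=; apply: eq_bigr => a _.
  rewrite ?mulr_suml; under eq_bigr do rewrite mulrDr.
  rewrite big_split /=; congr (_ + _); first by apply: eq_bigr => q _; rewrite mul1r.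
  rewrite -(pair_bigA _ (fun j (b : 'I_m) => e * f j)) exchange_big /=.
  by apply: eq_bigr => b _; rewrite mul1r mulr_sumr.
rewrite [X in X <= _](_ : _ = \sum_(w <- words_le k N)
    (K * (e * hnorm (h w) ^+ 2) + K' * (e * \sum_j hnorm (h (j :: w)) ^+ 2))); last first.
  by apply: eq_bigr => w _; exact: (sumE _ (fun j => hnorm (h (j :: w)) ^+ 2)).
rewrite big_split -!mulr_sumr /= -/s -!mulrA lerD2l ler_wpM2l ?K'_ge0//.
by rewrite ler_wpM2l// ltW.
Qed.

End Approximation.

Theorem theorem1p10 (R : realType) (H : hilbertType R) (n m k : nat)
  (n_gt0 : (0 < n)%N) (m_gt0 : (0 < m)%N) (k_gt0 : (0 < k)%N)
  (T : 'I_n -> 'B(H)) (wT : (joint_numerical_radius T <= 1%:E)%E)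
  (F : 'I_k -> 'M['B(fock R n)]_m)
  (F_An : forall j a b, nc_disc_algebra (F j a b)) :
  (joint_numerical_radius (fun j => mxop (map_mx (nc_eval T) (F j)))
   <= (opnorm (rowop (fun j => mxop (F j)))
       + 2 * Num.sqrt (\sum_j mxnorm (map_mx (@at_zero R n) (F j)) ^+ 2))%:E)%E.
Proof.
set c0 := opnorm _; set rho := Num.sqrt _.
have c0_ge0 : 0 <= c0 by exact: opnorm_ge0.
have rho_ge0 : 0 <= rho by exact: sqrtr_ge0.
apply: joint_numerical_radius_le => [|N h hN]; first by rewrite addr_ge0 ?mulr_ge0.
set s := \sum_(w <- _) hnorm _ ^+ 2.
have s_ge0 : 0 <= s by apply: sumr_ge0 => w _; exact: sqr_ge0.
pose K : R := \sum_(a < m) \sum_(q : 'I_k * 'I_m) 1.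
pose K' : R := \sum_(a < m) \sum_(b < m) 1.
have K0 : 0 <= K by apply: sumr_ge0 => a _; apply: sumr_ge0.
have K'0 : 0 <= K' by apply: sumr_ge0 => a _; apply: sumr_ge0.
(* Total coefficient of [e]: [2 K + 1] from the bound on Fock space and [K + K'] from the
   approximation at [T]. *)
apply: (@ler_mul_eps _ _ _ ((2 * K + 1 + (K + K')) * s)).
  by rewrite mulr_ge0// !addr_ge0// mulr_ge0.
move=> e e0.
have ex j a b := nc_eval_approx wT (F_An j a b) e0.
pose p j a b := projT1 (cid (ex j a b)).
have pS j a b : opnorm (ncpoly_eval (@left_creation R n) (p j a b) - F j a b) < e.
  by have [h1 _] := projT2 (cid (ex j a b)).
have pT j a b : opnorm (ncpoly_eval T (p j a b) - nc_eval T (F j a b)) < e.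
  by have [_ h2] := projT2 (cid (ex j a b)).
apply: le_trans (finite_family_bound e0 pS pT wT hN) _.
rewrite -/s -/c0 -/rho -/K -/K' le_eqVlt; apply/orP; left; apply/eqP; ring.
Qed.
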